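(* Let $(X,\theta,\mu,\alpha)$ be a Markov map with $\theta$-invariant probability measure $\mu$ and let $T:X\times\mathbf{V}\to X\times\mathbf{V}$, $T(x,g)=(\theta(x),\kappa_x(g))$, be its extension by a graph $\mathcal{G}=(\mathbf{V},\mathbf{E})$ through a nearest neighbour cocycle $\kappa$. Suppose that $T$ is topologically transitive, that $(X,\theta,\mu,\alpha)$ has an adequately embedded Gibbs-Markov structure $(\Omega,\beta,\eta)$ with induced map $\sigma:\Omega\to\Omega$, and that the induced graph extension $S:\Omega\times\mathbf{V}\to\Omega\times\mathbf{V}$, $S(x,g)=T^{\eta(x)}(x,g)=(\sigma(x),\hat\kappa_x(g))$, is topologically transitive and has uniform loops. Moreover, assume that the inducing time decays exponentially, that is $\limsup_{n\to\infty}\sqrt[n]{\mu(\{x\in\Omega:\eta(x)=n\})}<1$, and that $\hat\kappa$ finitely covers $\kappa$. If, for some $v\in\mathbf{V}$, $$\limsup_{n\to\infty}\sqrt[n]{\mu(\{x\in\Omega: T^n(x,v)\in X\times\{v\}\})}=1,$$ then $\mathcal{G}$ is $\mu$-amenable.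
   Context: Markov map. $(X,\theta,\mu,\alpha)$ consists of a standard probability space $(X,\mathcal{B},\mu)$, an at most countable partition $\alpha$ of $X$ into measurable sets of positive measure, and $\theta:X\to X$ such that for all $a,b\in\alpha$: $\theta|_a:a\to\theta(a)$ is invertible, bimeasurable and non-singular; and either $\mu(a\cap\theta(b))=0$ or $\mu(a\cap\theta(b)^c)=0$; moreover the sets $[w_1\ldots w_n]=\bigcap_{k=1}^n\theta^{-k+1}(w_k)$, $w_i\in\alpha$, $n\ge1$, generate $\mathcal{B}$ mod $\mu$. $\mathcal{W}^1=\alpha$; $\mathcal{W}^n$ is the set of admissible words $w=(w_1\ldots w_n)$, $w_i\in\alpha$, i.e. $\theta(w_i)\supset w_{i+1}$ (mod $\mu$); $\mathcal{W}^\infty=\bigcup_{n\geq 1}\mathcal{W}^n$; $|w|$ is the length of $w$. For $w\in\mathcal{W}^n$, $\tau_w:\theta^n([w])\to[w]$ is the inverse of $\theta^n|_{[w]}$ and $\varphi_w=\frac{d\mu\circ\tau_w}{d\mu}$. Gibbs-Markov map with full branches: a Markov map such that $\theta([w])=X$ mod $\mu$ for all $w\in\mathcal{W}^1$ and there are $C>0$, $r\in(0,1)$ with $|\log\varphi_w(x)-\log\varphi_w(y)|\le C\,d_r(x,y)$ for all $w\in\mathcal{W}^\infty$ and a.e. $x,y$, where $d_r(x,y)=r^{\min\{i:x_i\ne y_i\}}$ and $(x_i),(y_i)$ are the itineraries of $x,y$ with respect to the partition. Embedded Gibbs-Markov structure $(\Omega,\beta,\eta)$: $\Omega\subset X$ is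 a finite union of elements of $\alpha$, $\beta\subset\mathcal{W}^\infty$, $\eta:\beta\to\mathbb{N}$, $\{[u]:u\in\beta\}$ is a partition of $\Omega$ mod $\mu$, and, with $\eta(x):=\eta(u)$ and $\sigma(x):=\theta^{\eta(u)}(x)$ for $x\in[u]$, $u\in\beta$, and $\nu:=\mu(\Omega)^{-1}\mu|_\Omega$, $(\Omega,\sigma,\nu,\beta)$ is a Gibbs-Markov map with full branches. It is adequate if (i) there is a sequence $(C_n)$ with $\lim_n C_n/n=0$ and $|\log\varphi_w(x)-\log\varphi_w(y)|\le C_n\,d_\sigma(x,y)$ for all $w\in\mathcal{W}^n$, $a\in\alpha$ with $[wa]\ne\emptyset$, $[w],[a]\subset\Omega$, and all $x,y\in[a]$, where $d_\sigma$ is the metric $d_r$ with respect to $(\Omega,\sigma)$ and the partition $\beta$; (ii) there is an almost surely finite function $\eta^\dagger:\Omega\to\mathbb{N}$ such that for a.e. $x\in\Omega$ and all $l=0,\ldots,\eta(x)-1$ with $\theta^l(x)\in\Omega$ one has $\eta(x)-l\le\eta^\dagger(\theta^l(x))$. Graph extension. A graph is directed, $\mathbf{V}$ at most countable, $\mathbf{E}\subset\mathbf{V}\times\mathbf{V}$, $s(e),t(e)$ denote source and target of $e$. A nearest neighbour cocycle is $\kappa:X\times\mathbf{V}\to\mathbf{V}$, $(x,g)\mapsto\kappa_x(g)$, such that each $\kappa_x$ is a bijection of $\mathbf{V}$, $(g,\kappa_x(g))\in\mathbf{E}$, and $\kappa_x=\kappa_y$ whenever $x,y$ lie in the same element of $\alpha$.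 For $w\in\mathcal{W}^n$, $x\in[w]$: $\kappa_w=\kappa_x^n=\kappa_{\theta^{n-1}(x)}\circ\cdots\circ\kappa_x$. Thus $T^n(x,v)=(\theta^n(x),\kappa^n_x(v))$. For $x\in\Omega$, $\hat\kappa_x:=\kappa_x^{\eta(x)}$; $S$ is regarded as an extension of $(\Omega,\sigma,\nu,\beta)$ by $\hat\kappa$ (so $\hat\kappa_x$ is constant on each $[u]$, $u\in\beta$). $\hat{\mathcal{W}}^\infty$ denotes the finite words over $\beta$, and $\hat\kappa_w$ is defined for $w\in\hat{\mathcal{W}}^\infty$ as $\kappa_w$, with $(\theta,\kappa)$ replaced by $(\sigma,\hat\kappa)$. $T$ is topologically transitive if for all $a,b\in\alpha$, $g,h\in\mathbf{V}$ there is $n\ge1$ such that $T^n(a\times\{g\})\cap(b\times\{h\})$ has positive measure with respect to the product of $\mu$ and counting measure; analogously for $S$, with $\beta,\nu$ in place of $\alpha,\mu$. $S$ has uniform loops if there is a finite set $\mathcal{J}\subset\Omega$ with $g\in\{\hat\kappa_x(g):x\in\mathcal{J}\}$ for all $g\in\mathbf{V}$. $\hat\kappa$ finitely covers $\kappa$ if there is a finite set $\mathcal{K}\subset\hat{\mathcal{W}}^\infty$ such that for all $v\in\mathcal{W}^1$ and $g\in\mathbf{V}$ there is $w\in\mathcal{K}$ with $\kappa_v(g)=\hat\kappa_w(g)$. $\mu$-amenability: with $p(e)=\mu(\{x\in X:\kappa_x(s(e))=t(e)\})$ and $\partial^\epsilon K=\{v\in K:\exists e\in\mathbf{E}, s(e)=v,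 t(e)\notin K, p(e)>\epsilon\}$, $\mathcal{G}$ is $\mu$-amenable if $\lim_{\epsilon\to0}\inf\{|\partial^\epsilon K|/|K|:K\subset\mathbf{V},0<|K|<\infty\}=0$. *)

(* Defs.v *)
From HB Require Import structures.
From mathcomp Require Import all_boot all_order all_algebra finmap.
From mathcomp Require Import all_classical all_reals all_analysis.

Set Implicit Arguments.
Unset Strict Implicit.
Unset Printing Implicit Defensive.

Import Order.TTheory GRing.Theory Num.Theory.
Import numFieldTopology.Exports numFieldNormedType.Exports.

Local Open Scope classical_set_scope.
Local Open Scope ring_scope.

(** [X] is a standard Borel space: up to a bijection identifying the
    sigma-algebras, a Polish space with its Borel sets. *)
Definition standard_borel (R : realType) (d : measure_display)
    (X : measurableType d) : Prop :=
  exists (Y : completePseudoMetricType R) (f : X -> Y),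
    [/\ hausdorff_space Y,
        exists2 D : set Y, countable D & dense D,
        bijective f
      & forall B : set X,
          measurable B <-> <<s [set U : set Y | open U] >> (f @` B)].

(** * Maps with a partition

  The cells are a family [cell : I -> set X] indexed by the letters [i] with
  [P i].  Two instances are used: the ambient system, whose letters are all the
  elements of a countable type, and the induced system, whose letters are the
  words over the ambient letters which lie in [beta]. *)

Section Coding.
Context (X : Type) (I : choiceType) (P : set I) (cell : I -> set X)
        (theta : X -> X).

Fixpoint cyl (w : seq I) : set X :=
  if w is i :: w' then cell i `&` theta @^-1` cyl w' else setT.

(** [None] when [x] lies in no cell, which is possible for partitions mod
    null sets. *)
Definition symbol (x : X) : option I :=
  if pselect (exists i, P i /\ cell i x) is left h then Some (sval (cid h))
  else None.

Definition itinerary (x : X) (n : nat) : option I := symbol (iter n theta x).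

(** Indices start at [0]; two points with the same itinerary are at
    distance [0]. *)
Definition d_r (R : realType) (r : R) (x y : X) : R :=
  if pselect (exists n, itinerary x n != itinerary y n) is left h
  then r ^+ ex_minn h else 0.

(** [tau w] is the inverse of the restriction of [theta^n] to [cyl w], with
    [n = size w]; it is only meaningful on [cyl_image w]. *)
Definition cyl_image (w : seq I) : set X := iter (size w) theta @` cyl w.

Definition tau (x0 : X) (w : seq I) : X -> X :=
  'pinv_(fun=> x0) (cyl w) (iter (size w) theta).

End Coding.

Section MarkovMaps.
Context (R : realType) (d : measure_display) (X : measurableType d)
        (mu : probability X R) (I : choiceType) (P : set I)
        (cell : I -> set X) (theta : X -> X).
Local Open Scope ereal_scope.

(** The words in [W^oo]; those of length [n] form [W^n]. *)
Definition admissible (w : seq I) : Prop :=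
  [/\ w != [::], forall i, i \in w -> P i
    & sorted (fun i j => mu (cell j `\` theta @` cell i) == 0) w].

(** [phi] is a version of the density of [mu \o tau_w] with respect to [mu]
    on [theta^n [w]]. *)
Definition is_density (w : seq I) (phi : X -> R) : Prop :=
  [/\ measurable_fun (cyl_image cell theta w) phi,
      forall x, cyl_image cell theta w x -> (0 <= phi x)%R
    & forall B, measurable B -> B `<=` cyl_image cell theta w ->
        mu (tau cell theta point w @` B) = \int[mu]_(x in B) (phi x)%:E].

Definition cylinders : set (set X) :=
  [set C | exists w : seq I,
     [/\ w != [::], forall i, i \in w -> P i & C = cyl cell theta w] ].

(** A Markov map all of whose data are only given mod [mu]; the cells need only
    form a partition of [X] mod [mu]. *)
Record markov_map_mod : Prop := {
  mm_cell_measurable : forall i, P i -> measurable (cell i);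
  mm_cell_pos : forall i, P i -> 0 < mu (cell i);
  mm_disjoint : forall i j, P i -> P j -> i != j ->
    mu (cell i `&` cell j) = 0;
  mm_cover : mu (~` \bigcup_(i in P) cell i) = 0;
  mm_inj : forall i, P i -> {in cell i &, injective theta};
  mm_image_measurable : forall i, P i -> forall B, measurable B ->
    B `<=` cell i -> measurable (theta @` B);
  mm_preimage_measurable : forall i, P i -> forall B, measurable B ->
    measurable (cell i `&` theta @^-1` B);
  mm_nonsingular : forall i, P i -> forall B, measurable B ->
    B `<=` cell i -> (mu B = 0 <-> mu (theta @` B) = 0);
  mm_markov : forall i j, P i -> P j ->
    mu (cell i `&` theta @` cell j) = 0 \/
    mu (cell i `&` ~` (theta @` cell j)) = 0;
  mm_generating : forall B, measurable B -> exists B',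
    <<s cylinders >> B' /\ mu ((B `\` B') `|` (B' `\` B)) = 0
}.

Definition full_branches : Prop :=
  forall i, P i -> mu (~` (theta @` cell i)) = 0.

(** "for a.e. [x, y]" means for all [x, y] outside some null set. *)
Definition log_density_lipschitz (w : seq I) (D : set X) (dist : X -> X -> R)
    (C : R) : Prop :=
  forall phi, is_density w phi -> exists2 N : set X, mu.-negligible N &
    forall x y, D x -> D y -> cyl_image cell theta w x ->
      cyl_image cell theta w y -> ~ N x -> ~ N y ->
      (`| ln (phi x) - ln (phi y) | <= C * dist x y)%R.

Definition gibbs_markov_full (r : R) : Prop :=
  [/\ markov_map_mod, full_branches
    & exists2 C : R, (0 < C)%R &
        forall w, admissible w ->
          log_density_lipschitz w setT (d_r P cell theta r) C].

End MarkovMaps.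

(** A Markov map with a genuine partition, indexed by a countable type. *)
Definition markov_map (R : realType) (d : measure_display)
    (X : measurableType d) (mu : probability X R) (A : countType)
    (cell : A -> set X) (theta : X -> X) : Prop :=
  [/\ standard_borel R X, trivIset setT cell, \bigcup_a cell a = setT
    & markov_map_mod mu setT cell theta].

(** * Graph extensions *)

Section GraphExtensions.
Context (X : Type) (V : Type) (theta : X -> X) (kappa : X -> V -> V).

Definition extension (p : X * V) : X * V := (theta p.1, kappa p.1 p.2).

Fixpoint cocycle_iter (n : nat) (x : X) (g : V) : V :=
  if n is n'.+1 then kappa (iter n' theta x) (cocycle_iter n' x g) else g.

Lemma iter_extension n x g :
  iter n extension (x, g) = (iter n theta x, cocycle_iter n x g).
Proof. by elim: n => //= n ->. Qed.

Definition cellwise_constant (I : Type) (P : set I) (cell : I -> set X) : Prop :=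
  forall i x y g, P i -> cell i x -> cell i y -> kappa x g = kappa y g.

End GraphExtensions.

Definition nearest_neighbour_cocycle (X : Type) (A : Type)
    (cell : A -> set X) (V : Type) (E : set (V * V)) (kappa : X -> V -> V) :=
  [/\ forall x, bijective (kappa x),
      forall x g, E (g, kappa x g)
    & cellwise_constant kappa setT cell].

(** The product of [mu] and the counting measure on [V]. *)
Definition prod_counting (R : realType) (d : measure_display)
    (X : measurableType d) (mu : probability X R) (V : choiceType)
    (F : set (X * V)) : \bar R :=
  (\esum_(g in [set: V]) mu (ysection F g))%E.

Definition topologically_transitive (R : realType) (d : measure_display)
    (X : measurableType d) (mu : probability X R) (I : Type) (P : set I)
    (cell : I -> set X) (V : choiceType) (T : X * V -> X * V) : Prop :=
  forall i j g h, P i -> P j -> exists2 n : nat, (1 <= n)%N &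
    (0 < prod_counting mu
           ((iter n T @` (cell i `*` [set g])) `&` (cell j `*` [set h])))%E.

(** * Embedded Gibbs-Markov structures *)

Section Embedded.
Context (R : realType) (d : measure_display) (X : measurableType d)
        (mu : probability X R) (A : countType) (cell : A -> set X)
        (theta : X -> X).
Context (Omega : set X) (beta : set (seq A)) (eta : seq A -> nat).

Local Notation bcell := (cyl cell theta).

Definition induced_domain : set X := \bigcup_(u in beta) bcell u.

(** Off [induced_domain] the inducing time is given the dummy value [0], so
    that the induced map is the identity there. *)
Definition inducing_time (x : X) : nat :=
  if symbol beta bcell x is Some u then eta u else 0%N.

Definition induced_map (x : X) : X := iter (inducing_time x) theta x.

Definition induced_cocycle (V : Type) (kappa : X -> V -> V) (x : X) : V -> V :=
  cocycle_iter theta kappa (inducing_time x) x.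

Definition induced_extension (V : Type) (kappa : X -> V -> V) (p : X * V) :
    X * V :=
  iter (inducing_time p.1) (extension theta kappa) p.

Lemma induced_extensionE (V : Type) (kappa : X -> V -> V) :
  induced_extension kappa = extension induced_map (induced_cocycle kappa).
Proof. by apply/funext => -[x g]; rewrite /induced_extension iter_extension. Qed.

Definition normalized_restriction (nu : probability X R) : Prop :=
  forall B, measurable B ->
    nu B = (((fine (mu Omega))^-1)%:E * mu (B `&` Omega))%E.

Record embedded_gibbs_markov (nu : probability X R) (r : R) : Prop := {
  egm_finite_union :
    exists2 J : set A, finite_set J & Omega = \bigcup_(a in J) cell a;
  egm_pos : (0 < mu Omega)%E;
  egm_words : forall u, beta u -> admissible mu setT cell theta u;
  egm_disjoint : forall u v, beta u -> beta v -> u != v ->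
    mu (bcell u `&` bcell v) = 0%E;
  egm_cover :
    mu ((Omega `\` induced_domain) `|` (induced_domain `\` Omega)) = 0%E;
  egm_maps_to : {ae mu, forall x, Omega x -> Omega (induced_map x)};
  egm_nu : normalized_restriction nu;
  egm_gibbs_markov : gibbs_markov_full nu beta bcell induced_map r
}.

Definition adequate_distortion (r : R) : Prop :=
  exists C : nat -> R,
    (C n / n%:R @[n --> \oo] --> (0 : R)) /\
    forall (w : seq A) (a : A),
      admissible mu setT cell theta w ->
      bcell (rcons w a) !=set0 ->
      bcell w `<=` Omega -> cell a `<=` Omega ->
      log_density_lipschitz mu cell theta w (cell a)
        (d_r beta bcell induced_map r) (C (size w)).

(** [etad x = None] stands for an infinite value. *)
Definition adequate_time : Prop :=
  exists etad : X -> option nat,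
    {ae mu, forall x, Omega x -> etad x != None} /\
    {ae mu, forall x, Omega x -> forall l, (l < inducing_time x)%N ->
       Omega (iter l theta x) -> forall m, etad (iter l theta x) = Some m ->
       (inducing_time x - l <= m)%N}.

Definition adequately_embedded (nu : probability X R) : Prop :=
  exists r : R, [/\ 0 < r < 1, embedded_gibbs_markov nu r,
    adequate_distortion r & adequate_time].

Definition exponential_decay : Prop :=
  (limn_esup (fun n : nat =>
     mu [set x | Omega x /\ exists u, [/\ beta u, bcell u x & eta u = n] ]
       `^ (n%:R^-1)) < 1)%E.

(** The points of [J] are taken where the induced map is defined. *)
Definition uniform_loops (V : Type) (kappa : X -> V -> V) : Prop :=
  exists J : set X, [/\ finite_set J, J `<=` Omega `&` induced_domain &
    forall g, exists2 x, J x & induced_cocycle kappa x g = g].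

(** The [n]-th induced cocycle at any point of the cylinder of a word of length
    [n] over [beta] is the value of the cocycle on this word. *)
Definition finitely_covers (nu : probability X R) (V : Type)
    (kappa : X -> V -> V) : Prop :=
  exists K : set (seq (seq A)),
    [/\ finite_set K,
        forall w, K w -> admissible nu beta bcell induced_map w
      & forall (a : A) (g : V), exists2 w, K w &
          forall x y, cell a x -> cyl bcell induced_map w y ->
            kappa x g =
            cocycle_iter induced_map (induced_cocycle kappa) (size w) y g].

End Embedded.

(** * Amenability *)

Section Amenability.
Context (R : realType) (d : measure_display) (X : measurableType d)
        (mu : probability X R) (V : countType) (E : set (V * V))
        (kappa : X -> V -> V).
Local Open Scope fset_scope.

Definition edge_prob (e : V * V) : \bar R := mu [set x | kappa x e.1 = e.2].

Definition boundary (eps : R) (K : {fset V}) : {fset V} :=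
  [fset v in K | `[< exists e : V * V,
     [/\ E e, e.1 = v, e.2 \notin K & (eps%:E < edge_prob e)%E] >]].

Definition isoperimetric (eps : R) : R :=
  inf [set q : R | exists2 K : {fset V}, (0 < #|` K|)%N &
         q = #|` boundary eps K|%:R / #|` K|%:R].

Definition mu_amenable : Prop := isoperimetric eps @[eps --> 0^'+] --> (0 : R).

End Amenability.

(* Main.v *)
Require Import Defs.
From HB Require Import structures.
From mathcomp Require Import all_boot all_order all_algebra finmap.
From mathcomp Require Import all_classical all_reals all_analysis.
From mathcomp Require Import measurable_realfun ring lra.
Import Order.TTheory GRing.Theory Num.Theory.
Import numFieldTopology.Exports numFieldNormedType.Exports.

(* If the graph is not amenable, finite sets [K] of vertices expand by a fixed
   factor under the finitely many letters of [beta] that cover [kappa] or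
   realize the loops.  Cheeger's inequality and the loops (which exclude
   periodicity) make the averaging operator over these letters a contraction
   of [l^2 V].  Words over [beta] have Gibbs weights, which are multiplicative
   up to a constant; a Doeblin splitting of the weights transfers the
   contraction to sums over words, so that the return probabilities of the
   induced extension after [k] steps decay exponentially in [k].  A return of
   the original extension at time [n] happens after at least [n %/ m] inducing
   steps, unless the first [n %/ m] inducing times add up to more than [n]; for
   large [m] the latter has exponentially small probability, because the
   inducing time has exponential tails. *)

Set Implicit Arguments.
Unset Strict Implicit.
Unset Printing Implicit Defensive.

Local Open Scope classical_set_scope.
Local Open Scope ring_scope.

(** * Square-summable functions *)

(** Three obstacles shape the estimates. The averaging operator over [S] is not self-adjoint, so its
    norm is bounded directly: at each vertex a letter fixing it leaves only [n - 1] differences in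
    Cauchy-Schwarz, and the term saved is the Dirichlet form that Cheeger's inequality bounds below.
    The alphabet [beta] may be infinite, so sums are taken over words in a finite alphabet [s]
    containing [S], with constants independent of [s], and measures are recovered by countable
    subadditivity; l^2 norms are likewise bounds on finite sums. Finally, [n] need not be a sum of
    inducing times: after [K] induced steps a time [j <= n] remains, and the [nu]-probability of
    reaching [v] from [g] in [j] steps, as a function of [g], lies in the unit ball of l^2 because
    the fibre maps are injective. Summing over all [j] costs a factor [n + 1], which exponential
    decay absorbs. *)

Section SeqSums.
Context (R : realFieldType).

Lemma ler_sum_uniq_subset (T : eqType) (s t : seq T) (h : T -> R) :
  uniq s -> uniq t -> {subset s <= t} -> (forall x, 0 <= h x) ->
  \sum_(x <- s) h x <= \sum_(x <- t) h x.
Proof.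
move=> us ut st h0.
have e : perm_eq t (s ++ [seq x <- t | x \notin s]).
  apply: uniq_perm => //.
    rewrite cat_uniq us filter_uniq ?andbT //=.
    by apply/hasPn => x; rewrite mem_filter => /andP[].
  move=> x; rewrite mem_cat mem_filter.
  by case: (boolP (x \in s)) => //= /st.
by rewrite (perm_big _ e) /= big_cat /= lerDl sumr_ge0.
Qed.

Lemma sum_inj_le (T U : eqType) (s : seq T) (t : seq U) (k : T -> U)
    (h : U -> R) :
  uniq s -> uniq t -> injective k -> (forall x, 0 <= h x) ->
  (forall x, x \notin t -> h x = 0) ->
  \sum_(x <- s) h (k x) <= \sum_(x <- t) h x.
Proof.
move=> us ut kI h0 ht; rewrite -(big_map k xpredT).
rewrite (bigID (mem t)) /= [X in _ + X]big1 ?addr0; last by move=> i /ht.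
rewrite -big_filter; apply: ler_sum_uniq_subset => //.
  by rewrite filter_uniq // map_inj_uniq.
by move=> x; rewrite mem_filter => /andP[].
Qed.

Lemma sqr_sum_le (T : Type) (s : seq T) (d : T -> R) :
  (\sum_(x <- s) d x) ^+ 2 <= (size s)%:R * \sum_(x <- s) d x ^+ 2.
Proof.
case: (posnP (size s)) => [/size0nil ->|s0].
  by rewrite !big_nil expr2 !mulr0.
set n := (size s)%:R : R; have n0 : 0 < n by rewrite ltr0n.
set D := \sum_(x <- s) d x; set Q := \sum_(x <- s) d x ^+ 2.
have : 0 <= \sum_(x <- s) (n * d x - D) ^+ 2 by apply: sumr_ge0 => i _; exact: sqr_ge0.
have e i : (n * d i - D) ^+ 2 = n ^+ 2 * d i ^+ 2 + (- (n *+ 2) * D * d i + D ^+ 2).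
  by ring.
under eq_bigr do rewrite e.
rewrite !big_split /= -!mulr_sumr -/D -/Q.
rewrite big_const_seq count_predT iter_addr_0 -mulr_natr -/n.
rewrite (_ : _ + _ = n * (n * Q - D ^+ 2)); last by ring.
by rewrite pmulr_rge0 // subr_ge0.
Qed.

Lemma exists_seq_argmin (T : eqType) (s : seq T) (h : T -> R) :
  s != [::] -> exists2 x, x \in s & {in s, forall y, h x <= h y}.
Proof.
elim: s => // x [|y s] IH _.
  by exists x => [|z]; rewrite inE // => /eqP ->.
have [//|z zs zmin] := IH.
have [xz|zx] := leP (h x) (h z).
  exists x; rewrite ?mem_head // => t; rewrite inE => /predU1P[-> //|/zmin].
  exact: le_trans.
exists z; first by rewrite in_cons zs orbT.
by move=> t; rewrite inE => /predU1P[->|/zmin //]; exact: ltW.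
Qed.

End SeqSums.

Section SquareSums.
Context (R : realFieldType) (V : eqType).
Implicit Types (f g : V -> R) (m : R).

(** The l^2 norm is tested on finite duplicate-free families, so that no infinite sum has to be
    formed. *)
Definition l2_le f m :=
  forall s : seq V, uniq s -> \sum_(x <- s) f x ^+ 2 <= m ^+ 2.

Lemma l2_le_mono f g m : (forall x, 0 <= f x <= g x) -> l2_le g m -> l2_le f m.
Proof.
move=> fg gm s us; apply: le_trans (gm s us).
by apply: ler_sum => x _; have /andP[f0 fgx] := fg x; rewrite lerXn2r ?nnegrE // (le_trans f0).
Qed.

Lemma l2_le_weaken f m m' : 0 <= m <= m' -> l2_le f m -> l2_le f m'.
Proof.
move=> /andP[m0 mm'] fm s /fm /le_trans; apply.
by rewrite lerXn2r ?nnegrE // (le_trans m0).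
Qed.

Lemma l2_le_scale f m a : l2_le f m -> l2_le (fun x => a * f x) (a * m).
Proof.
move=> fm s us; under eq_bigr do rewrite exprMn.
by rewrite -mulr_sumr exprMn ler_wpM2l ?sqr_ge0 // fm.
Qed.

Lemma l2_le_add f g m m' : 0 <= m -> 0 <= m' -> l2_le f m -> l2_le g m' ->
  l2_le (fun x => f x + g x) (m + m').
Proof.
move=> m0 m0' fm gm s us; have := fm s us; have := gm s us.
set G := \sum_(_ <- _) _; set F := \sum_(_ <- _) _ => Gm Fm.
have zero (h : V -> R) : \sum_(x <- s) h x ^+ 2 <= 0 ^+ 2 -> {in s, forall x, h x = 0}.
  rewrite expr0n /= => h0 x xs; apply/eqP; rewrite -sqrf_eq0 eq_le sqr_ge0 andbT.
  apply: le_trans h0; rewrite (big_rem x) //= lerDl sumr_ge0 // => i _.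
  exact: sqr_ge0.
have [m_eq0|m_neq0] := eqVneq m 0.
  rewrite m_eq0 add0r; apply: le_trans Gm; rewrite m_eq0 in Fm.
  rewrite /G big_seq [leRHS]big_seq.
  by apply: ler_sum => x /(zero f Fm) ->; rewrite add0r.
have [m_eq0'|m_neq0'] := eqVneq m' 0.
  rewrite m_eq0' addr0; apply: le_trans Fm; rewrite m_eq0' in Gm.
  rewrite /F big_seq [leRHS]big_seq.
  by apply: ler_sum => x /(zero g Gm) ->; rewrite addr0.
have mp : 0 < m by rewrite lt_def m_neq0.
have mp' : 0 < m' by rewrite lt_def m_neq0'.
(* Young's inequality for the cross term, with the weights for which the two bounds add up to
   exactly [(m + m') ^+ 2]; they require both norms to be nonzero. *)
apply: (@le_trans _ _ ((1 + m' / m) * F + (1 + m / m') * G)).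
  rewrite /F /G !mulr_sumr -big_split /=; apply: ler_sum => x _.
  rewrite -subr_ge0 (_ : _ - _ = (m' * f x - m * g x) ^+ 2 / (m * m')).
    by rewrite divr_ge0 ?sqr_ge0 // mulr_ge0.
  by field; rewrite m_neq0 m_neq0'.
apply: (@le_trans _ _ ((1 + m' / m) * m ^+ 2 + (1 + m / m') * m' ^+ 2)).
  by apply: lerD; rewrite ler_wpM2l // addr_ge0 // divr_ge0.
rewrite (_ : _ + _ = (m + m') ^+ 2) //.
by field; rewrite m_neq0 m_neq0'.
Qed.

End SquareSums.

(** * Cheeger's inequality and the spectral gap *)

Section Gap.
Context (R : realFieldType) (V : eqType) (I : eqType) (S : seq I)
  (k : I -> V -> V) (c : R).
Hypothesis k_inj : forall b, injective (k b).
Hypothesis c_gt0 : 0 < c.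
Hypothesis expansion : forall K : seq V, uniq K ->
  c * (size K)%:R <= \sum_(b <- S) (count (fun g => k b g \notin K) K)%:R.

(** Level sets are peeled off from the bottom: lowering [h] by its minimum over [K] removes a point
    of the support, and [expansion] of [K] pays for the removed layer. *)
Lemma coarea (K : seq V) (h : V -> R) : uniq K -> (forall g, 0 <= h g) ->
  (forall g, g \notin K -> h g = 0) ->
  c * \sum_(g <- K) h g <=
  \sum_(b <- S) \sum_(g <- K) Num.max 0 (h g - h (k b g)).
Proof.
move: {2}(size K) (erefl (size K)) => n.
elim: n K h => [|n IH] K h sK uK h0 hK.
  rewrite (size0nil sK) big_nil mulr0 sumr_ge0 // => b _.
  by rewrite big_nil.
have [g0 g0K g0min] : exists2 x, x \in K & {in K, forall y, h x <= h y}.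
  by apply: exists_seq_argmin; case: (K) sK.
set m := h g0 in g0min.
pose h' g := if g \in K then h g - m else 0.
have h'0 g : 0 <= h' g by rewrite /h'; case: ifP => // /g0min; rewrite subr_ge0.
have h'g0 : h' g0 = 0 by rewrite /h' g0K subrr.
have sK' : size (rem g0 K) = n by rewrite size_rem // sK.
have h'K g : g \notin rem g0 K -> h' g = 0.
  rewrite mem_rem_uniq // !inE negb_and negbK => /orP[/eqP -> //|gK].
  by rewrite /h' (negbTE gK).
have := IH (rem g0 K) h' sK' (rem_uniq _ uK) h'0 h'K.
have sumK' (F : V -> R) : F g0 = 0 -> \sum_(g <- rem g0 K) F g = \sum_(g <- K) F g.
  by move=> F0; rewrite [RHS](big_rem g0) //= F0 add0r.
rewrite sumK' // => IH'.
have -> : \sum_(g <- K) h g = \sum_(g <- K) h' g + m * (size K)%:R.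
  rewrite -sum1_size natr_sum mulr_sumr -big_split /= big_seq [RHS]big_seq.
  by apply: eq_bigr => g gK; rewrite /h' gK mulr1 subrK.
rewrite mulrDr mulrCA.
apply: (le_trans (lerD IH' (ler_wpM2l (h0 g0) (expansion uK)))).
rewrite mulr_sumr -big_split /=; apply: ler_sum => b _.
rewrite sumK'; last by rewrite h'g0 sub0r max_l // oppr_le0.
rewrite -sum1_count natr_sum mulr_sumr [X in _ + X]big_mkcond /= -big_split /=.
rewrite big_seq [leRHS]big_seq; apply: ler_sum => g gK.
rewrite {1}/h' gK /h'; case: ifP => kgK /=.
  by rewrite addr0 opprB addrA subrK.
rewrite (hK (k b g)) ?kgK // !subr0 mulr1 max_r ?subr_ge0 ?g0min //.
by rewrite subrK max_r.
Qed.

Hypothesis S_gt0 : (0 < size S)%N.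
Let n : R := (size S)%:R.

(* Coarea inequality for [f ^+ 2], then AM-GM on [x^2 - y^2 = (x - y) (x + y)]. *)
Lemma cheeger (K : seq V) (f : V -> R) : uniq K -> (forall g, 0 <= f g) ->
  (forall g, g \notin K -> f g = 0) ->
  c ^+ 2 / (4 * n) * \sum_(g <- K) f g ^+ 2 <=
  \sum_(b <- S) \sum_(g <- K) (f (k b g) - f g) ^+ 2.
Proof.
move=> uK f0 fK.
have n0 : 0 < n by rewrite ltr0n.
have n_ge0 := ltW n0; have c_ge0 := ltW c_gt0.
set F := \sum_(g <- K) f g ^+ 2; set X := \sum_(b <- S) _.
have cF : c * F <= \sum_(b <- S) \sum_(g <- K) Num.max 0 (f g ^+ 2 - f (k b g) ^+ 2).
  by apply: (coarea uK) => g; [exact: sqr_ge0 | move=> /fK ->; rewrite expr0n].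
have {}cF : c * F <= 2 * n / c * X + c / 2 * F.
  apply: (le_trans cF).
  (* The AM-GM weight is chosen so that the second sum is at most [c / 2 * F], half of the left
     side, into which it is absorbed. *)
  apply: (@le_trans _ _ (2 * n / c * X +
     \sum_(b <- S) \sum_(g <- K) (c / (4 * n) * (f g ^+ 2 + f (k b g) ^+ 2)))).
    rewrite /X mulr_sumr -big_split /=; apply: ler_sum => b _.
    rewrite mulr_sumr -big_split /=; apply: ler_sum => g _.
    set x := f g; set y := f (k b g).
    have x0 : 0 <= x by exact: f0.
    have y0 : 0 <= y by exact: f0.
    rewrite ge_max; apply/andP; split.
      by apply: addr_ge0; apply: mulr_ge0; rewrite ?addr_ge0 ?sqr_ge0 // divr_ge0 ?mulr_ge0.
    rewrite -subr_ge0.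
    rewrite (_ : _ - _ = (4 * n * (y - x) + c * (x + y)) ^+ 2 / (8 * n * c) +
       c / (8 * n) * (x - y) ^+ 2).
      by apply: addr_ge0; apply: mulr_ge0; rewrite ?sqr_ge0 // ?divr_ge0 ?invr_ge0 ?mulr_ge0.
    by field; rewrite !gt_eqF.
  rewrite lerD2l.
  have -> : c / 2 * F = \sum_(b <- S) (c / (4 * n) * (F + F)).
    rewrite big_const_seq count_predT iter_addr_0 -mulr_natr -/n.
    by field; rewrite gt_eqF.
  apply: ler_sum => b _; rewrite -mulr_sumr ler_wpM2l //.
    by rewrite divr_ge0 ?mulr_ge0.
  rewrite big_split /= lerD2l.
  apply: (@sum_inj_le _ _ _ _ _ _ (fun g => f g ^+ 2)) => //.
    by move=> x; exact: sqr_ge0.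
  by move=> x /fK ->; rewrite expr0n.
have {}cF : c / 2 * F <= 2 * n / c * X by lra.
rewrite (_ : _ / _ * F = (c / (2 * n)) * (c / 2 * F)); last first.
  by field; rewrite gt_eqF.
rewrite (_ : X = (c / (2 * n)) * (2 * n / c * X)); last by field; rewrite !gt_eqF.
by rewrite ler_wpM2l // divr_ge0 ?mulr_ge0.
Qed.

Hypothesis loops : forall g, exists2 b, b \in S & k b g = g.

(** The loop letter contributes a zero difference, so Cauchy-Schwarz for the differences runs over
    [n - 1] letters; the missing unit is the subtracted sum. *)
Lemma sqr_sum_loop_le (f : V -> R) (g : V) :
  (\sum_(b <- S) f (k b g)) ^+ 2 <=
  n * \sum_(b <- S) f (k b g) ^+ 2 - \sum_(b <- S) (f (k b g) - f g) ^+ 2.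
Proof.
have [b0 b0S kb0] := loops g.
have [d e] : exists d : I -> R, forall b, f (k b g) = d b + f g.
  by exists (fun b => f (k b g) - f g) => b; rewrite subrK.
have := sqr_sum_le (rem b0 S) d.
have d0 : d b0 = 0 by apply: (addIr (f g)); rewrite -e kb0 add0r.
have sumS (F : I -> R) : F b0 = 0 -> \sum_(b <- rem b0 S) F b = \sum_(b <- S) F b.
  by move=> F0; rewrite [RHS](big_rem b0) //= F0 add0r.
rewrite !sumS //; last by rewrite d0 expr0n.
have -> : (size (rem b0 S))%:R = n - 1 :> R.
  by rewrite size_rem // -subn1 natrB.
move=> dS.
have e1 b : f (k b g) - f g = d b by rewrite e addrK.
under [X in _ - X]eq_bigr do rewrite e1.
have e2 b : f (k b g) ^+ 2 = d b ^+ 2 + (f g *+ 2 * d b + f g ^+ 2).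
  by rewrite e; ring.
under [X in n * X]eq_bigr do rewrite e2.
under [in leLHS]eq_bigr do rewrite e.
rewrite !big_split /= -mulr_sumr !big_const_seq count_predT !iter_addr_0.
rewrite -(mulr_natr (f g) (size S)) -(mulr_natr (f g ^+ 2) (size S)) -/n.
move: dS; set D := \sum_(b <- S) d b; set Q := \sum_(b <- S) d b ^+ 2.
move=> dS; rewrite -subr_ge0.
rewrite (_ : _ - Q - _ = (n - 1) * Q - D ^+ 2) ?subr_ge0 //.
by ring.
Qed.

Lemma mean_gap (s K : seq V) (f : V -> R) : uniq s -> uniq K ->
  (forall g, 0 <= f g) -> (forall g, g \notin K -> f g = 0) ->
  \sum_(g <- s) (\sum_(b <- S) f (k b g)) ^+ 2 <=
  (n ^+ 2 - c ^+ 2 / (4 * n)) * \sum_(g <- K) f g ^+ 2.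
Proof.
move=> us uK f0 fK.
have n0 : 0 < n by rewrite ltr0n.
set F := \sum_(g <- K) f g ^+ 2.
(* Enlarging [s] by [K] only increases the left side, and it makes the Cheeger sum over [K] part of
   the subtracted terms. *)
have ut : uniq (undup (s ++ K)) by exact: undup_uniq.
apply: (@le_trans _ _ (\sum_(g <- undup (s ++ K)) (\sum_(b <- S) f (k b g)) ^+ 2)).
  apply: ler_sum_uniq_subset => // [x|x]; last exact: sqr_ge0.
  by rewrite mem_undup mem_cat => ->.
apply: (le_trans (ler_sum _ (fun g _ => sqr_sum_loop_le f g))).
rewrite sumrB -mulr_sumr mulrBl; apply: lerB.
  rewrite expr2 -mulrA ler_wpM2l ?ler0n // exchange_big /=.
  have -> : n * F = \sum_(b <- S) F.
    by rewrite big_const_seq count_predT iter_addr_0 -mulr_natl.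
  apply: ler_sum => b _.
  apply: (@sum_inj_le _ _ _ _ _ _ (fun g => f g ^+ 2)) => //.
    by move=> x; exact: sqr_ge0.
  by move=> x /fK ->; rewrite expr0n.
apply: (le_trans (cheeger uK f0 fK)); rewrite [leRHS]exchange_big /=.
apply: ler_sum => b _; apply: ler_sum_uniq_subset => // [x|x]; last exact: sqr_ge0.
by rewrite mem_undup mem_cat orbC => ->.
Qed.

Lemma l2_le_sum_gap : exists2 q : R, 0 <= q < 1 &
  forall f m, (forall g, 0 <= f g) -> l2_le f m ->
    l2_le (fun g => \sum_(b <- S) f (k b g)) (n * q * m).
Proof.
have n0 : 0 < n by rewrite ltr0n.
pose y := c ^+ 2 / (4 * n).
have y0 : 0 < y by rewrite divr_gt0 ?exprn_gt0 ?mulr_gt0.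
(* First-order upper bound for the square root of [1 - y / n ^+ 2]; the maximum covers large [y]. *)
pose q := Num.max 0 (1 - y / (2 * n ^+ 2)).
have q0 : 0 <= q by rewrite le_max lexx.
exists q; first rewrite q0 gt_max ltr01 /=.
  by rewrite ltrBlDr ltrDl divr_gt0 // mulr_gt0 ?exprn_gt0.
have qP : n ^+ 2 - y <= (n * q) ^+ 2.
  rewrite exprMn; have [z0|z0] := leP 0 (1 - y / (2 * n ^+ 2)).
    rewrite /q max_r // -subr_ge0.
    rewrite (_ : _ - _ = (y / (2 * n)) ^+ 2) ?sqr_ge0 //.
    by field; rewrite gt_eqF.
  apply: (@le_trans _ _ 0); last by rewrite mulr_ge0 ?sqr_ge0.
  rewrite subr_le0; move: z0; rewrite subr_lt0 ltr_pdivlMr ?mulr_gt0 ?exprn_gt0 //.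
  by rewrite mul1r => /ltW; apply: le_trans; rewrite ler_peMl ?sqr_ge0 // ler1n.
move=> f m f0 fm s us.
(* Only the values of [f] at images of [s] matter; cutting [f] off outside them gives the finite
   support required by [mean_gap]. *)
pose K := undup (flatten [seq [seq k b g | b <- S] | g <- s]).
have uK : uniq K by exact: undup_uniq.
pose f' g := if g \in K then f g else 0.
have f'0 g : 0 <= f' g by rewrite /f'; case: ifP.
have f'K g : g \notin K -> f' g = 0 by rewrite /f' => /negbTE ->.
have -> : \sum_(g <- s) (\sum_(b <- S) f (k b g)) ^+ 2 =
    \sum_(g <- s) (\sum_(b <- S) f' (k b g)) ^+ 2.
  rewrite big_seq [RHS]big_seq; apply: eq_bigr => g gs; congr (_ ^+ 2).
  rewrite big_seq [RHS]big_seq; apply: eq_bigr => b bS.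
  rewrite /f' mem_undup ifT //; apply/flattenP.
  by exists [seq k b g | b <- S]; exact: map_f.
apply: (le_trans (mean_gap us uK f'0 f'K)).
have -> : \sum_(g <- K) f' g ^+ 2 = \sum_(g <- K) f g ^+ 2.
  by rewrite big_seq [RHS]big_seq; apply: eq_bigr => g gK; rewrite /f' gK.
have F0 : 0 <= \sum_(g <- K) f g ^+ 2 by apply: sumr_ge0 => g _; exact: sqr_ge0.
rewrite exprMn; apply: (le_trans (ler_wpM2r F0 qP)).
by rewrite ler_wpM2l ?sqr_ge0 // fm.
Qed.

End Gap.

(** * Sums over words *)

Section Words.
Context (V I : eqType) (k : I -> V -> V).

Definition act (w : seq I) (g : V) : V := foldl (fun h b => k b h) g w.

Lemma act_cat u w g : act (u ++ w) g = act w (act u g).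
Proof. exact: foldl_cat. Qed.

Lemma act_inj w : (forall b, injective (k b)) -> injective (act w).
Proof. by move=> kI; elim: w => //= b w IH g h /IH /kI. Qed.

Fixpoint words (s : seq I) (n : nat) : seq (seq I) :=
  if n is n'.+1 then [seq b :: w | b <- s, w <- words s n'] else [:: [::]].

Lemma mem_words s n w : (w \in words s n) = (size w == n) && all (mem s) w.
Proof.
elim: n w => [|n IH] [|b w] //=.
  by apply/negbTE/negP => /allpairsP[[c v] []].
apply/allpairsP/idP => [[[c v] /= [cs vn [-> ->]]]|/and3P[e bs ws]].
  by move: vn; rewrite IH eqSS => /andP[-> ->]; rewrite cs.
by exists (b, w); split => //=; rewrite IH -eqSS e.
Qed.

Lemma words_uniq s n : uniq s -> uniq (words s n).
Proof.
move=> us; elim: n => //= n IH; apply: allpairs_uniq => //.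
by move=> [a u] [b v] _ _ /= [-> ->].
Qed.

Lemma size_words s n : size (words s n) = (size s ^ n)%N.
Proof. by elim: n => //= n IH; rewrite size_allpairs IH expnS. Qed.

Lemma sum_words_add (R : nmodType) s m n (F : seq I -> R) :
  \sum_(w <- words s (m + n)) F w =
  \sum_(u <- words s m) \sum_(w <- words s n) F (u ++ w).
Proof.
elim: m F => [|m IH] F; first by rewrite big_seq1.
rewrite addSn /= !big_allpairs_dep; apply: eq_bigr => b _.
by rewrite (IH (fun w => F (b :: w))).
Qed.

Hypothesis k_inj : forall b, injective (k b).

(* A point of [K] moved out of [K] by [act w] leaves [K] through a single
   letter at some intermediate step. *)
Lemma count_act_le (S : seq I) (K : seq V) w : uniq K -> {subset w <= S} ->
  (count (fun g => act w g \notin K) K <=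
   size w * \sum_(b <- S) count (fun g => k b g \notin K) K)%N.
Proof.
move=> uK; set B := (\sum_(b <- S) _)%N.
elim: w => [|b w IH] wS /=.
  rewrite mul0n leqNgt -has_count; apply/hasPn => g gK.
  by rewrite negbK.
have {}IH : (count (fun g => act w g \notin K) K <= size w * B)%N.
  by apply: IH => x xw; apply: wS; rewrite inE xw orbT.
have bS : b \in S by apply: wS; rewrite mem_head.
rewrite mulSn.
apply: (@leq_trans (count (fun g => k b g \notin K) K +
   count (fun g => (k b g \in K) && (act w (k b g) \notin K)) K)).
  rewrite -count_predUI; apply: leq_trans (leq_addr _ _).
  by apply: sub_count => g /= ->; rewrite andbT orNb.
apply: leq_add; first by rewrite /B (big_rem b) //= leq_addr.
apply: leq_trans IH; rewrite -!size_filter -(size_map (k b)).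
apply: uniq_leq_size; first by rewrite map_inj_uniq // filter_uniq.
move=> g /mapP[h]; rewrite !mem_filter => /andP[/andP[hK hw] _] ->.
by rewrite hK hw.
Qed.

(** By the union bound over [W], expansion under words costs single letters at most the total length
    of these words; the successor in [L] avoids a zero denominator. *)
Lemma letter_expansion (R : realFieldType) (S : seq I) (W : seq (seq I)) (e : R) :
  0 < e -> (forall w, w \in W -> {subset w <= S}) ->
  (forall K : seq V, uniq K ->
     e * (size K)%:R <= (count (fun g => has (fun w => act w g \notin K) W) K)%:R) ->
  exists2 c : R, 0 < c & forall K : seq V, uniq K ->
    c * (size K)%:R <= \sum_(b <- S) (count (fun g => k b g \notin K) K)%:R.
Proof.
move=> e0 WS eK; pose L := (\sum_(w <- W) size w).+1.
exists (e / L%:R); first by rewrite divr_gt0 // ltr0n.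
move=> K uK; rewrite mulrAC ler_pdivrMr ?ltr0n //; apply: (le_trans (eK K uK)).
rewrite -natr_sum -natrM ler_nat.
have le1 : (count (fun g => has (fun w => act w g \notin K) W) K <=
    \sum_(w <- W) count (fun g => act w g \notin K) K)%N.
  elim: (W) => [|w W' IH] /=; first by rewrite big_nil count_pred0.
  rewrite big_cons; apply: leq_trans (leq_add (leqnn _) IH).
  by rewrite -count_predUI leq_addr.
apply: (leq_trans le1).
set B := (\sum_(b <- S) _)%N.
rewrite mulnC mulSn; apply: leq_trans (leq_addl _ _).
rewrite (big_distrl B) big_seq [leqRHS]big_seq; apply: leq_sum => w wW.
by apply: count_act_le => //; exact: WS.
Qed.

End Words.

(** * Contraction of word sums with quasi-multiplicative weights *)

Section WordSums.
Context (R : realType) (V I : eqType) (k : I -> V -> V) (P : I -> Prop)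
  (p : seq I -> R) (D : R) (S : seq I).
Hypothesis k_inj : forall b, injective (k b).
Hypothesis p_ge0 : forall w, 0 <= p w.
Hypothesis p_nil : p [::] = 1.
Let good (w : seq I) := forall b, b \in w -> P b.
Hypothesis p_gt0 : forall w, good w -> 0 < p w.
Hypothesis D_gt0 : 0 < D.
Hypothesis p_cat_le : forall u w, good u -> good w -> p (u ++ w) <= D * (p u * p w).
Hypothesis p_cat_ge : forall u w, good u -> good w -> p u * p w <= D * p (u ++ w).
Hypothesis p_sum : forall u s, good u -> good s -> uniq s ->
  \sum_(b <- s) p (rcons u b) <= p u.
Hypothesis S_uniq : uniq S.
Hypothesis S_good : good S.
Hypothesis S_gt0 : (0 < size S)%N.
Variable q : R.
Hypothesis q01 : 0 <= q < 1.
Hypothesis gap : forall (f : V -> R) m, (forall g, 0 <= f g) -> l2_le f m ->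
  l2_le (fun g => \sum_(b <- S) f (k b g)) ((size S)%:R * q * m).

Let goodD u w : good u -> good w -> good (u ++ w).
Proof. by move=> gu gw b; rewrite mem_cat => /orP[/gu|/gw]. Qed.

Let good_words s n w : good s -> w \in words s n -> good w.
Proof. by move=> gs; rewrite mem_words => /andP[_ /allP ws] b /ws /gs. Qed.

Lemma l2_le_inj (f : V -> R) (h : V -> V) m :
  injective h -> l2_le f m -> l2_le (fun g => f (h g)) m.
Proof.
move=> hI fm s us; rewrite -(big_map h xpredT (fun g => f g ^+ 2)).
by apply: fm; rewrite map_inj_uniq.
Qed.

Lemma l2_le_sum (T : eqType) (s : seq T) (F : T -> V -> R) (m : T -> R) :
  (forall i, i \in s -> 0 <= m i) -> (forall i, i \in s -> l2_le (F i) (m i)) ->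
  l2_le (fun g => \sum_(i <- s) F i g) (\sum_(i <- s) m i).
Proof.
elim: s => [|i s IH] m0 Fm.
  move=> s _; rewrite big_nil expr0n /= big1 // => g _.
  by rewrite big_nil expr0n.
move=> t ut; rewrite big_cons; under [leLHS]eq_bigr do rewrite big_cons.
move: t ut; apply: l2_le_add.
- by apply: m0; exact: mem_head.
- by rewrite big_seq; apply: sumr_ge0 => j js; apply: m0; rewrite in_cons js orbT.
- by apply: Fm; exact: mem_head.
- by apply: IH => j js; [apply: m0|apply: Fm]; rewrite in_cons js orbT.
Qed.

Lemma sum_words_le u s n : good u -> good s -> uniq s ->
  \sum_(w <- words s n) p (u ++ w) <= p u.
Proof.
move=> gu gs us; elim: n u gu => [|n IH] u gu /=.
  by rewrite big_seq1 cats0.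
rewrite big_allpairs_dep; apply: le_trans (p_sum gu gs us).
rewrite big_seq [leRHS]big_seq; apply: ler_sum => b bs.
under eq_bigr do rewrite -cat_rcons.
by apply: IH; rewrite -cats1; apply: goodD => // c; rewrite inE => /eqP ->; exact: gs.
Qed.

Lemma gap_words (f : V -> R) m n : (forall g, 0 <= f g) -> l2_le f m ->
  l2_le (fun g => \sum_(w <- words S n) f (act k w g))
    (((size S)%:R * q) ^+ n * m).
Proof.
move=> f0 fm; elim: n => [|n IH].
  by rewrite mul1r => s us; under eq_bigr do rewrite big_seq1; exact: fm.
rewrite exprS -mulrA => s us.
under eq_bigr do rewrite big_allpairs_dep.
apply: (gap (f := fun g => \sum_(w <- words S n) f (act k w g))) us => // g.
exact: sumr_ge0.
Qed.

(** The prefix [u] enters only through the weight; its action on [g] is left out, so that the norm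
    in [g] can be bounded in proportion to [p u]. *)
Definition word_sum (s : seq I) (f : V -> R) n u g :=
  \sum_(w <- words s n) p (u ++ w) * f (act k w g).

Lemma word_sum_ge0 s f n u g : (forall g, 0 <= f g) -> 0 <= word_sum s f n u g.
Proof. by move=> f0; apply: sumr_ge0 => w _; rewrite mulr_ge0. Qed.

Lemma word_sum_add s f m n u g : word_sum s f (m + n) u g =
  \sum_(v <- words s m) word_sum s f n (u ++ v) (act k v g).
Proof.
rewrite /word_sum sum_words_add; apply: eq_bigr => v _; apply: eq_bigr => w _.
by rewrite catA act_cat.
Qed.

Lemma word_sum_le s f n u g : (forall g, 0 <= f g) -> good s -> good u ->
  word_sum s f n u g <= D * p u * word_sum s f n [::] g.
Proof.
move=> f0 gs gu; rewrite /word_sum mulr_sumr big_seq [leRHS]big_seq.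
apply: ler_sum => w ws; rewrite mulrA ler_wpM2r // -mulrA p_cat_le //.
exact: good_words ws.
Qed.

(* [c p(u)] is split off from each [p(uv)] with [v] a word over [S]: on this
   part quasi-independence replaces the weights [p(uvw)] by multiples of
   [p(w)], so that the gap applies; the contraction [q^r] beats the constant
   [D]. *)
Lemma word_sum_contraction : exists r : nat, exists t : R,
  [/\ (0 < r)%N, 0 <= t < 1 & forall s f n M,
  good s -> uniq s -> {subset S <= s} -> (forall g, 0 <= f g) -> 0 <= M ->
  (forall u, good u -> l2_le (word_sum s f n u) (p u * M)) ->
  forall u, good u -> l2_le (word_sum s f (r + n) u) (p u * (t * M))].
Proof.
have /andP[q0 q1] := q01.
have [r0 [r0p Dq]] : exists r : nat, (0 < r)%N /\ D * q ^+ r <= 2^-1.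
  have /cvgrPdist_lt : (fun n : nat => D * q ^+ n) @ \oo --> (D * 0 : R).
    by apply: cvgMr; apply: cvg_expr; rewrite ger0_norm.
  move=> /(_ 2^-1); rewrite invr_gt0 ltr0n => /(_ isT) [N _ NP].
  exists N.+1; split => //; have := NP N.+1 (leqnSn N).
  rewrite mulr0 sub0r normrN ger0_norm; first exact: ltW.
  by rewrite mulr_ge0 ?exprn_ge0 // ltW.
pose W := words S r0.
(* The finite minimum over [W] gives a lower bound on the conditional weights [p (u ++ v) / p u]
   that is uniform in the prefix [u]. *)
have [c c0 cW] : exists2 c : R, 0 < c & forall v, v \in W -> c <= p v / D.
  have gW v : v \in W -> 0 < p v / D.
    by move=> vW; rewrite divr_gt0 // p_gt0 //; exact: good_words vW.
  elim: (W) gW => [|v W' IH] gW; first by exists 1.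
  have [|c c0 cP] := IH; first by move=> w ww; apply: gW; rewrite inE ww orbT.
  exists (Num.min c (p v / D)); first by rewrite lt_min c0 gW ?mem_head.
  move=> w; rewrite inE => /predU1P[->|/cP]; first by rewrite ge_min lexx orbT.
  by apply: le_trans; rewrite ge_min lexx.
pose N : R := (size W)%:R.
have N0 : 0 < N by rewrite /N size_words ltr0n expn_gt0 S_gt0.
have cpW u v : good u -> v \in W -> c * p u <= p (u ++ v).
  move=> gu vW; apply: (le_trans (ler_wpM2r (p_ge0 u) (cW v vW))).
  rewrite mulrAC ler_pdivrMr // mulrC [leRHS]mulrC p_cat_ge //.
  exact: good_words vW.
have sumW u s : good u -> good s -> uniq s -> {subset S <= s} ->
    N * c * p u <= \sum_(v <- words s r0) p (u ++ v).
  move=> gu gs us Ss.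
  apply: (@le_trans _ _ (\sum_(v <- W) p (u ++ v))).
    rewrite -mulrA mulr_natl -iter_addr_0 -(count_predT W) -big_const_seq.
    by rewrite big_seq [leRHS]big_seq; apply: ler_sum => v; exact: cpW.
  apply: ler_sum_uniq_subset => //; try exact: words_uniq.
  move=> v; rewrite !mem_words => /andP[-> /allP vS] /=.
  by apply/allP => b /vS; exact: Ss.
have Nc1 : N * c <= 1.
  have g0 : good [::] by [].
  have := sumW [::] S g0 S_good S_uniq (fun b bS => bS).
  rewrite p_nil mulr1 => /le_trans; apply.
  by rewrite (le_trans (sum_words_le _ g0 S_good S_uniq)) // p_nil.
(* Of the mass [p u] the share [N * c] passes through the gap and comes back with a factor at most
   one half; the rest is kept unchanged. *)
exists r0, (1 - N * c / 2); split => //.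
  apply/andP; split; first by lra.
  by rewrite ltrBlDr ltrDl divr_gt0 // mulr_gt0.
move=> s f n M gs us Ss f0 M0 fM u gu.
(* The proportion of [p (u ++ v)] to split off, normalized so that the split mass is the same for
   all [v] in [W]. *)
pose tau v := if v \in W then c * p u / p (u ++ v) else 0.
have puv v : v \in words s r0 -> 0 < p (u ++ v).
  by move=> vs; apply: p_gt0; apply: goodD => //; exact: good_words vs.
have tau01 v : v \in words s r0 -> 0 <= tau v <= 1.
  move=> vs; rewrite /tau; case: ifP => [vW|_]; last by rewrite lexx ler01.
  rewrite divr_ge0 ?mulr_ge0 ?(ltW c0) //= ler_pdivrMr ?puv // mul1r.
  exact: cpW.
have WE (F : seq I -> R) : \sum_(v <- words s r0) (if v \in W then F v else 0) =
    \sum_(v <- W) F v.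
  rewrite -big_mkcond /= -big_filter; apply: perm_big; apply: uniq_perm.
  - by rewrite filter_uniq // words_uniq.
  - exact: words_uniq.
  move=> v; rewrite mem_filter; case: (boolP (v \in W)) => //=.
  rewrite /W !mem_words => /andP[-> /allP vS] /=.
  by apply/allP => b /vS; exact: Ss.
(* After [word_sum_le] the split part carries one common weight, which leaves the plain sum over [W]
   that [gap_words] contracts. *)
pose first g := D * c * p u * \sum_(v <- W) word_sum s f n [::] (act k v g).
pose second g := \sum_(v <- words s r0)
  (1 - tau v) * word_sum s f n (u ++ v) (act k v g).
apply: (@l2_le_mono _ _ _ (fun g => first g + second g)).
  move=> g; rewrite word_sum_ge0 //= word_sum_add.
  rewrite (eq_bigr (fun v => tau v * word_sum s f n (u ++ v) (act k v g) +
     (1 - tau v) * word_sum s f n (u ++ v) (act k v g))); last first.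
    by move=> v _; rewrite -mulrDl addrC subrK mul1r.
  rewrite big_split /= lerD2r /first mulr_sumr -WE big_seq [leRHS]big_seq.
  apply: ler_sum => v vs; rewrite /tau; case: ifP => vW; last by rewrite mul0r.
  have guv : good (u ++ v) by apply: goodD => //; exact: good_words vs.
  apply: (le_trans (ler_wpM2l _ (word_sum_le n (act k v g) f0 gs guv))).
    by rewrite divr_ge0 ?mulr_ge0 // ltW.
  rewrite le_eqVlt; apply/orP; left; apply/eqP; field.
  by rewrite gt_eqF ?puv.
have g0 : good [::] by [].
apply: (@l2_le_weaken _ _ _ (D * c * p u * (((size S)%:R * q) ^+ r0 * M) +
   \sum_(v <- words s r0) (1 - tau v) * (p (u ++ v) * M))); last first.
  apply: l2_le_add.
  - by rewrite !mulr_ge0 ?exprn_ge0 // ?mulr_ge0 // ltW.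
  - rewrite big_seq sumr_ge0 // => v /tau01 /andP[_ t1].
    by rewrite !mulr_ge0 // subr_ge0.
  - apply: l2_le_scale; apply: gap_words; first by move=> g; exact: word_sum_ge0.
    by have := fM [::] g0; rewrite p_nil mul1r.
  - apply: l2_le_sum => v vs; have /andP[_ t1] := tau01 v vs.
      by rewrite !mulr_ge0 // subr_ge0.
    apply: l2_le_scale; apply: l2_le_inj; first exact: act_inj.
    by apply: fM; apply: goodD => //; exact: good_words vs.
have -> : \sum_(v <- words s r0) (1 - tau v) * (p (u ++ v) * M) =
    (\sum_(v <- words s r0) p (u ++ v) - N * (c * p u)) * M.
  have -> : N * (c * p u) = \sum_(v <- words s r0) tau v * p (u ++ v).
    rewrite mulr_natl -iter_addr_0 -(count_predT W) -big_const_seq -WE.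
    rewrite big_seq [RHS]big_seq; apply: eq_bigr => v vs; rewrite /tau.
    by case: ifP => _; rewrite ?mul0r // divfK // gt_eqF ?puv.
  rewrite -sumrB mulr_suml; apply: eq_bigr => v _; ring.
have sle := sum_words_le r0 gu gs us.
have sge := sumW u s gu gs us Ss.
set Q := \sum_(v <- words s r0) p (u ++ v) in sle sge *.
apply/andP; split.
  apply: addr_ge0; first by rewrite !mulr_ge0 ?exprn_ge0 // ?mulr_ge0 // ltW.
  by rewrite mulr_ge0 // subr_ge0 mulrA.
rewrite exprMn -natrX -size_words -/W -/N.
rewrite (_ : _ * _ + _ = (N * c * (D * q ^+ r0) * p u + (Q - N * c * p u)) * M); last by ring.
rewrite (_ : p u * _ = (p u * (1 - N * c / 2)) * M); last by ring.
rewrite ler_wpM2r //.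
have : N * c * (D * q ^+ r0) * p u <= N * c * 2^-1 * p u.
  by rewrite ler_wpM2r // ler_wpM2l // mulr_ge0 // ltW.
lra.
Qed.

(** The constants [r] and [t] precede the alphabet [s]: this uniformity is what lets finite
    alphabets exhaust an infinite one. *)
Lemma word_sum_decay : exists r : nat, exists t : R, [/\ (0 < r)%N, 0 <= t < 1 &
  forall s f, good s -> uniq s -> {subset S <= s} -> (forall g, 0 <= f g) ->
  l2_le f 1 -> forall n g,
  \sum_(w <- words s n) p w * f (act k w g) <= t ^+ (n %/ r)].
Proof.
have [r [t [r0 t01 step]]] := word_sum_contraction.
exists r, t; split => // s f gs us Ss f0 f1 n g.
have /andP[t0 t1] := t01.
(* Each block of [r] letters contracts; for the [m] remaining letters the total mass bound suffices.
   A one-point family then gives the pointwise estimate. *)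
have main j m u : good u -> l2_le (word_sum s f (j * r + m) u) (p u * t ^+ j).
  elim: j u => [|j IH] u gu; last first.
    rewrite exprS mulSn -addnA; apply: step => //; exact: exprn_ge0.
  rewrite mulr1 mul0n add0n.
  apply: (@l2_le_weaken _ _ _ (\sum_(w <- words s m) p (u ++ w) * 1)).
    rewrite sumr_ge0 //=; first by under eq_bigr do rewrite mulr1; exact: sum_words_le.
    by move=> w _; rewrite mulr1.
  apply: l2_le_sum => w _; first by rewrite mulr1.
  by apply: l2_le_scale; apply: l2_le_inj => //; exact: act_inj.
have g0 : good [::] by [].
have := main (n %/ r)%N (n %% r)%N [::] g0 [:: g] isT.
rewrite -divn_eq p_nil mul1r big_seq1 ler_pXn2r // ?nnegrE ?exprn_ge0 //.
exact: word_sum_ge0.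
Qed.

End WordSums.

(** * Markov maps *)

Section CountableUnions.
Context (R : realType) (d : measure_display) (X : measurableType d)
  (nu : probability X R) (I : countType).
Local Open Scope ereal_scope.

Lemma countable_bigcup_measurable (P : set I) (F : I -> set X) :
  (forall i, P i -> measurable (F i)) -> measurable (\bigcup_(i in P) F i).
Proof.
move=> mF; rewrite bigcup_mkcond; apply: countable_bigcupT_measurable => // i.
by case: ifPn => // /set_mem; exact: mF.
Qed.

(** Passes from sums over finite families of words to the measure of a set covered by countably
    many, up to a null set. The exact partial inverse [pickle_inv] enumerates each index at most
    once. *)
Lemma measure_countable_cover_le (P : set I) (F : I -> set X) (A N : set X) (c : R) :
  measurable A -> nu.-negligible N -> (forall i, P i -> measurable (F i)) ->
  A `<=` N `|` \bigcup_(i in P) F i ->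
  (forall s : seq I, uniq s -> (forall i, i \in s -> P i) ->
     (\sum_(i <- s) fine (nu (F i)) <= c)%R) ->
  (fine (nu A) <= c)%R.
Proof.
move=> mA [N' [mN' nN' NN']] mF AF sc.
pose G n := if @choice.pickle_inv I n is Some i then
  if i \in P then F i else set0 else set0.
have mG n : measurable (G n).
  by rewrite /G; case: choice.pickle_inv => // i; case: ifPn => // /set_mem; exact: mF.
have AG : A `<=` N' `|` \bigcup_n G n.
  move=> x /AF [/NN'|[i Pi Fi]]; first by left.
  by right; exists (choice.pickle i) => //; rewrite /G choice.pickleK_inv mem_set.
have mGU : measurable (\bigcup_n G n) by exact: bigcup_measurable.
have G_part n : \sum_(0 <= k < n) nu (G k) <= c%:E.
  pose sel t := [seq i <- pmap (@choice.pickle_inv I) t | i \in P].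
  have -> : \sum_(0 <= k < n) nu (G k) = \sum_(i <- sel (iota 0 n)) nu (F i).
    rewrite /index_iota subn0; elim: (iota 0 n) => [|k t IH]; first by rewrite !big_nil.
    rewrite big_cons IH /sel /G /=; case: (@choice.pickle_inv I k) => [i|] /=.
      by case: ifP; rewrite ?big_cons // measure0 add0e.
    by rewrite measure0 add0e.
  have selP i : i \in sel (iota 0 n) -> P i by rewrite mem_filter => /andP[/set_mem].
  under eq_big_seq => i /selP/mF mFi do rewrite -(fineK (fin_num_measure nu _ mFi)).
  rewrite sumEFin lee_fin; apply: sc => //; apply: filter_uniq.
  by apply: (pmap_uniq (g := choice.pickle)); [exact: choice.pickle_invK | exact: iota_uniq].
rewrite -lee_fin (fineK (fin_num_measure nu _ mA)).
apply: (@le_trans _ _ (nu (N' `|` \bigcup_n G n))).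
  by apply: le_measure; rewrite ?inE //; exact: measurableU.
have h : nu (N' `|` \bigcup_n G n) <= nu N' + nu (\bigcup_n G n) by exact: measureU2.
apply: (le_trans h); rewrite nN' add0e.
have h2 : nu (\bigcup_n G n) <= \sum_(0 <= n <oo) nu (G n).
  exact: measure_sigma_subadditive.
apply: (le_trans h2).
apply: lime_le; first by apply: is_cvg_nneseries.
by apply: nearW => n; exact: G_part.
Qed.

Lemma negligible_countable_bigcup (P : set I) (F : I -> set X) :
  (forall i, P i -> nu.-negligible (F i)) -> nu.-negligible (\bigcup_(i in P) F i).
Proof.
move=> nF; pose G n := if @choice.pickle_inv I n is Some i then
  if i \in P then F i else set0 else set0.
apply: (@negligibleS _ _ _ _ (\bigcup_n G n)).
  move=> x [i Pi Fi]; exists (choice.pickle i) => //.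
  by rewrite /G choice.pickleK_inv mem_set.
apply: negligible_bigcup => n; rewrite /G.
case: choice.pickle_inv => [i|]; last exact: negligible_set0.
by case: ifPn => [/set_mem/nF //|_]; exact: negligible_set0.
Qed.

End CountableUnions.

Section MarkovWords.
Context (R : realType) (d : measure_display) (X : measurableType d)
  (nu : probability X R) (I : countType) (P : set I) (cell : I -> set X)
  (theta : X -> X).
Hypothesis markov : markov_map_mod nu P cell theta.
Local Notation cyl := (cyl cell theta).
Local Notation good w := (forall i, i \in w -> P i).
Implicit Types (w : seq I) (B : set X).

Lemma good_cons i w : good (i :: w) -> P i /\ good w.
Proof.
by move=> g; split => [|j jw]; apply: g; rewrite in_cons ?eqxx ?jw ?orbT.
Qed.

Lemma cyl_cat u w : cyl (u ++ w) = cyl u `&` iter (size u) theta @^-1` cyl w.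
Proof.
elim: u => [|i u IH] /=; first by rewrite setTI.
by rewrite IH -setIA; apply/seteqP; split => x /=; rewrite -iterSr.
Qed.

Lemma cyl_preimage_measurable w B : good w -> measurable B ->
  measurable (cyl w `&` iter (size w) theta @^-1` B).
Proof.
move=> gw mB; elim: w gw => [|i w IH] /=; first by rewrite setTI.
move=> /good_cons[Pi gw].
rewrite (_ : _ `&` _ = cell i `&` theta @^-1`
    (cyl w `&` iter (size w) theta @^-1` B)).
  exact/(mm_preimage_measurable markov Pi)/IH.
by apply/seteqP; split => x /=; rewrite -iterS iterSr; tauto.
Qed.

Lemma cyl_measurable w : good w -> measurable (cyl w).
Proof.
by move=> gw; have := cyl_preimage_measurable gw measurableT; rewrite setIT.
Qed.

Lemma cyl_inj w : good w -> {in cyl w &, injective (iter (size w) theta)}.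
Proof.
elim: w => [_ x y _ _ //|i w IH] /=.
move=> /good_cons[Pi gw] x y; rewrite !inE => -[ix wx] [iy wy].
rewrite -!iterS !iterSr => /IH e; apply: (mm_inj markov Pi); rewrite ?inE //.
by apply: e => //; rewrite inE.
Qed.

Lemma cyl_image_measurable w B : good w -> measurable B -> B `<=` cyl w ->
  measurable (iter (size w) theta @` B) /\
  (nu B = 0%E <-> nu (iter (size w) theta @` B) = 0%E).
Proof.
elim: w B => [|i w IH] B /=; first by move=> _ mB _; rewrite image_id.
move=> /good_cons[Pi gw] mB Bw.
have Bi : B `<=` cell i by move=> x /Bw[].
have -> : [set iter (size w).+1 theta x | x in B] =
    iter (size w) theta @` (theta @` B).
  by rewrite image_comp; apply: eq_imagel => x _; rewrite iterSr.
have mtB : measurable (theta @` B) by exact: (mm_image_measurable markov Pi).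
have [|? nul] := IH (theta @` B) gw mtB; first by move=> _ [x /Bw[_ ?] <-].
by split => //; rewrite -nul; exact: (mm_nonsingular markov Pi).
Qed.

(** Nonsingularity speaks of images, and the image of this preimage is contained in a null set. *)
Lemma preimage_null i N : P i -> nu.-negligible N ->
  nu.-negligible (cell i `&` theta @^-1` N).
Proof.
move=> Pi [N' [mN' nN' NN']].
have mB := mm_preimage_measurable markov Pi mN'.
exists (cell i `&` theta @^-1` N'); split => //; last first.
  by apply: setIS => x; exact: NN'.
apply/(mm_nonsingular markov Pi mB (@subIsetl _ _ _)).
apply: (subset_measure0 _ mN' _ nN') => [|_ [x [_ ?] <-] //].
exact: (mm_image_measurable markov Pi mB (@subIsetl _ _ _)).
Qed.

Lemma cyl_preimage_null w N : good w -> nu.-negligible N ->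
  nu.-negligible (cyl w `&` iter (size w) theta @^-1` N).
Proof.
move=> gw nN; elim: w gw => [|i w IH] /=; first by rewrite setTI.
move=> /good_cons[Pi gw]; have := preimage_null Pi (IH gw).
by apply: negligibleS => x /= [[ix wx]]; rewrite -iterS iterSr.
Qed.

Hypothesis full : full_branches nu P cell theta.

(** Compared with [cyl w], the word [i :: w] loses only the image of the part of [cyl w] outside the
    image of [cell i]; that part is null by full branches, and its image by nonsingularity. *)
Lemma cyl_image_full w : good w -> nu (~` cyl_image cell theta w) = 0%E.
Proof.
rewrite /cyl_image; elim: w => [_|i w IH].
  by rewrite image_id setCT measure0.
move=> /good_cons[Pi gw]; have mw := cyl_measurable gw.
have mti : measurable (theta @` cell i).
  by apply: (mm_image_measurable markov Pi) => //; exact: (mm_cell_measurable markov).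
have e : iter (size (i :: w)) theta @` cyl (i :: w) =
    iter (size w) theta @` (cyl w `&` theta @` cell i).
  apply/seteqP; split => [_ [x [ix wx] <-]|_ [y [wy [x ix xy]] <-]].
    by exists (theta x); rewrite ?iterSr //; split => //; exists x.
  by exists x; rewrite ?iterSr ?xy //; split => //=; rewrite xy.
have [mim _] := cyl_image_measurable gw (measurableI _ _ mw mti) (@subIsetl _ _ _).
have [mD nD] := cyl_image_measurable gw (measurableD mw mti) (@subDsetl _ _ _).
have [mA _] := cyl_image_measurable gw mw (@subset_refl _ _).
rewrite e; apply: (subset_measure0 (measurableC mim)
    (measurableU _ _ (measurableC mA) mD)).
  move=> x xN; have [[y wy yx]|xA] := pselect ((iter (size w) theta @` cyl w) x).
    right; exists y => //; split => // yi; apply: xN; exists y => //.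
  by left.
apply: null_set_setU => //; first exact: measurableC.
  exact: IH.
apply/nD; apply: (subset_measure0 (measurableD mw mti) (measurableC mti)) => [x []//|].
exact: full.
Qed.

Lemma tau_image w B : good w -> B `<=` cyl_image cell theta w ->
  tau cell theta point w @` B = cyl w `&` iter (size w) theta @^-1` B.
Proof.
move=> gw Bw; apply/seteqP; split => [_ [y By <-]|x [wx Bx]].
  have [x wx xy] := Bw _ By.
  rewrite -xy /tau pinvKV ?inE //; last exact: cyl_inj.
  by split => //=; rewrite xy.
exists (iter (size w) theta x) => //.
by rewrite /tau pinvKV ?inE //; exact: cyl_inj.
Qed.

Lemma good_admissible w : w != [::] -> good w -> admissible nu P cell theta w.
Proof.
move=> w0 gw; split => //; case: w w0 gw => //= i w _.
elim: w i => //= j w IH i gw.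
have [Pi gw'] := good_cons gw; rewrite IH // andbT.
have Pj : P j by have [] := good_cons gw'.
have mti : measurable (theta @` cell i).
  by apply: (mm_image_measurable markov Pi) => //; exact: (mm_cell_measurable markov).
apply/eqP; apply: (subset_measure0 _ (measurableC mti)) => //.
- by apply: measurableD => //; exact: (mm_cell_measurable markov).
- exact: full.
Qed.

End MarkovWords.

(** * Bounded distortion *)

Section Distortion.
Context (R : realType) (d : measure_display) (X : measurableType d)
  (nu : probability X R) (I : countType) (P : set I) (cell : I -> set X)
  (theta : X -> X).
Hypothesis markov : markov_map_mod nu P cell theta.
Hypothesis full : full_branches nu P cell theta.
Local Notation cyl := (cyl cell theta).
Local Notation good w := (forall i, i \in w -> P i).
Local Notation push w B := (nu (cyl w `&` iter (size w) theta @^-1` B)).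
Implicit Types (w : seq I) (B : set X).
Local Open Scope ereal_scope.

(** A Radon-Nikodym derivative, available by nonsingularity. The distortion hypothesis quantifies
    over versions of the density and says nothing until one is exhibited. *)
Lemma push_density w : good w -> exists f : X -> R,
  [/\ measurable_fun setT f, forall x, (0 <= f x)%R &
   forall B, measurable B -> push w B = \int[nu]_(x in B) (f x)%:E].
Proof.
move=> gw; pose m B := push w B.
have m0 : m set0 = 0 by rewrite /m preimage_set0 setI0 measure0.
have m_ge0 B : 0 <= m B by exact: measure_ge0.
have m_sigma : semi_sigma_additive m.
  move=> F mF tF mUF; rewrite /m preimage_bigcup setI_bigcupr.
  apply: measure_semi_sigma_additive => [i||].
  - exact: (cyl_preimage_measurable markov).
  - apply/trivIsetP => i j _ _ ij; have /trivIsetP/(_ i j Logic.I Logic.I ij) := tF.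
    rewrite -!subset0 => FF x [[_ /= Fi] [_ /= Fj]].
    exact: (FF (iter (size w) theta x)).
  - apply: bigcupT_measurable => i.
    exact: (cyl_preimage_measurable markov).
have m_fin : fin_num_fun m.
  by move=> B mB; apply: fin_num_measure; exact: (cyl_preimage_measurable markov).
pose M1 := isMeasure.Build _ _ _ m m0 m_ge0 m_sigma.
pose M : {measure set X -> \bar R} := HB.pack m M1.
pose M2 := Measure_isFinite.Build _ _ _ M m_fin.
pose M' : {finite_measure set X -> \bar R} := HB.pack m M1 M2.
have dom : M' `<< nu.
  apply/null_content_dominatesP => B mB nB.
  change (m B = 0); apply: (negligibleP _ _).1.
    exact: (cyl_preimage_measurable markov).
  apply: (cyl_preimage_null markov gw); exact/negligibleP.
have [f [f0 ffin fint fE]] := radon_nikodym_sigma_finite dom.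
exists (fine \o f); split.
- apply/measurable_EFinP; rewrite (_ : _ \o _ = f).
    exact: (measurable_int nu fint).
  by apply/funext => x /=; rewrite fineK.
- by move=> x; exact: fine_ge0.
- move=> B mB; rewrite -[LHS]/(M' B) fE //.
  by apply: eq_integral => x _ /=; rewrite fineK.
Qed.

Lemma d_r_le1 (r : R) x y : (0 < r < 1)%R -> (d_r P cell theta r x y <= 1)%R.
Proof.
move=> /andP[r0 r1]; rewrite /d_r; case: pselect => // h.
by rewrite exprn_ile1 // ltW.
Qed.

Lemma push_le_ge (r C : R) w : (0 < r < 1)%R -> (0 < C)%R -> good w ->
  w != [::] ->
  log_density_lipschitz nu cell theta w setT (d_r P cell theta r) C ->
  forall B, measurable B ->
    push w B <= (expR (C + C))%:E * (nu (cyl w) * nu B) /\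
    nu (cyl w) * nu B <= (expR (C + C))%:E * push w B.
Proof.
move=> r01 C0 gw w0 lip.
have [f [mf f0 fE]] := push_density gw.
have mw := cyl_measurable markov gw.
have [mim _] := cyl_image_measurable markov gw mw (@subset_refl _ _).
rewrite -/(cyl_image cell theta w) in mim.
have dens : is_density nu cell theta w f.
  split => //; first exact: measurable_funS mf.
  by move=> B mB Bw; rewrite (tau_image markov) // fE.
have [N [N' [mN' nN' NN']] fN] := lip f dens.
(* A zero of the density escapes the bound on logarithms, where [ln 0] is a default value;
   nonsingularity makes such points negligible. *)
pose Z := cyl_image cell theta w `&` f @^-1` [set 0%R].
have mZ : measurable Z by apply: measurableI => //; rewrite -[X in measurable X]setTI; exact: mf.
have nZ : nu Z = 0.
  have pZ : push w Z = 0.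
    rewrite fE // (eq_integral (cst 0)) ?integral0 // => x.
    by rewrite inE => -[_ /= ->].
  have mpZ := cyl_preimage_measurable markov gw mZ.
  have [_ [/(_ pZ) + _]] := cyl_image_measurable markov gw mpZ (@subIsetl _ _ _).
  congr (nu _ = 0); apply/seteqP; split => [_ [x [_ Zx] <-] //|x Zx].
  by have [[y wy yx] _] := Zx; exists y => //; split => //=; rewrite yx.
(* Off this null set the density is positive and the distortion bound holds, which leaves a
   reference point [x0]. *)
pose Bad := (~` cyl_image cell theta w `|` Z) `|` N'.
have mBad : measurable Bad.
  by apply: measurableU => //; apply: measurableU => //; exact: measurableC.
have nBad : nu Bad = 0.
  apply: null_set_setU => //; first by apply: measurableU => //; exact: measurableC.
  apply: null_set_setU => //; first exact: measurableC.
  exact: (cyl_image_full markov full).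
have [x0 gx0] : exists x0, ~ Bad x0.
  apply/not_existsP => h.
  have := probability_setT nu.
  rewrite (_ : setT = Bad); last by apply/seteqP; split => x // _; apply: contrapT; exact: h.
  by rewrite nBad => /eqP; rewrite eq_sym onee_eq0.
have gd x : ~ Bad x -> [/\ cyl_image cell theta w x, (0 < f x)%R & ~ N x].
  move=> nx; have ix : cyl_image cell theta w x.
    by apply: contrapT => h; apply: nx; left; left.
  split => //.
    rewrite lt_def f0 andbT; apply/eqP => fx; apply: nx; left; right.
    by split.
  by move=> /NN' ?; apply: nx; right.
have [ix0 fx0 Nx0] := gd _ gx0.
have ratio x y : ~ Bad x -> ~ Bad y -> (f x <= expR C * f y)%R.
  move=> /gd[ix fx Nx] /gd[iy fy Ny].
  have := fN x y Logic.I Logic.I ix iy Nx Ny.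
  have dC : (C * d_r P cell theta r x y <= C)%R.
    by rewrite ler_piMr ?d_r_le1 // ltW.
  move=> /le_trans -/(_ _ dC); rewrite ler_norml => /andP[_].
  rewrite lerBlDr => h; rewrite -[leLHS]lnK ?posrE // -[X in (_ <= _ * X)%R]lnK ?posrE //.
  by rewrite -expRD ler_expR.
set a := f x0 in fx0.
have mfE B : measurable_fun B (fun x => (f x)%:E).
  by apply/measurable_EFinP; exact: measurable_funS mf.
have ubd B : measurable B -> push w B <= (expR C * a)%:E * nu B.
  move=> mB; rewrite fE // -integral_cst //.
  apply: ae_ge0_le_integral => //.
  - by move=> x _; rewrite lee_fin.
  - by move=> x _; rewrite lee_fin mulr_ge0 ?expR_ge0 // ltW.
  - exists Bad; split => // x; apply: contra_notP => nx _.
    by rewrite /= lee_fin; exact: ratio.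
have lbd B : measurable B -> a%:E * nu B <= (expR C)%:E * push w B.
  move=> mB; rewrite fE // -ge0_integralZl_EFin ?expR_ge0 //; last first.
    by move=> x _; rewrite lee_fin.
  rewrite -integral_cst //; apply: ae_ge0_le_integral => //.
  - by move=> x _; rewrite lee_fin ltW.
  - by move=> x _; rewrite -EFinM lee_fin mulr_ge0 ?expR_ge0.
  - by under eq_fun do rewrite -EFinM; apply/measurable_EFinP;
      apply: measurable_funM => //; exact: measurable_funS mf.
  - exists Bad; split => // x; apply: contra_notP => nx _.
    by rewrite /= -EFinM lee_fin; exact: ratio.
(* The case [B = setT] compares the reference value [a] with [nu (cyl w)]; exchanging them costs the
   second factor [expR C]. *)
have pT : push w setT = nu (cyl w) by rewrite preimage_setT setIT.
have uT := ubd _ (@measurableT _ X); have lT := lbd _ (@measurableT _ X).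
rewrite pT probability_setT !mule1 in uT lT.
move=> B mB; have mwB := cyl_preimage_measurable markov gw mB.
have := ubd B mB; have := lbd B mB; move: uT lT.
rewrite -(fineK (fin_num_measure nu _ mw)) -(fineK (fin_num_measure nu _ mwB)).
rewrite -(fineK (fin_num_measure nu _ mB)) -!EFinM !lee_fin.
have : (0 <= fine (nu B))%R by apply: fine_ge0; exact: measure_ge0.
set b := fine (nu B); set c := fine (nu (cyl w)); set e := fine (nu (_ `&` _)).
rewrite expRD; have := expR_gt0 C; set q := expR C => q0 b0 h1 h2 h3 h4; split.
  apply: (le_trans h4); rewrite -!mulrA ler_wpM2l ?(ltW q0) // mulrA.
  by rewrite ler_wpM2r.
apply: (@le_trans _ _ (q * a * b)%R); first by rewrite ler_wpM2r.
by rewrite -!mulrA ler_wpM2l ?(ltW q0).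
Qed.

(** The Gibbs-Markov constant is uniform over words, hence so is [D]; for [B] a cylinder this is
    quasi-multiplicativity of the weights. *)
Lemma gibbs_quasi_bernoulli (r : R) : (0 < r < 1)%R ->
  gibbs_markov_full nu P cell theta r ->
  exists2 D : R, (1 <= D)%R & forall w B, good w -> measurable B ->
    push w B <= D%:E * (nu (cyl w) * nu B) /\
    nu (cyl w) * nu B <= D%:E * push w B.
Proof.
move=> r01 [_ _ [C C0 lip]].
have D1 : (1 <= expR (C + C))%R by rewrite -expR0 ler_expR addr_ge0 // ltW.
(* Admissible words are nonempty, so the empty word is treated apart; there [1 <= D] suffices. *)
exists (expR (C + C)) => // w B gw mB; have [->|w0] := eqVneq w [::].
  rewrite /= setTI probability_setT mul1e.
  by split; rewrite -[leLHS]mul1e lee_wpmul2r // lee_fin.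
apply: (push_le_ge r01 C0 gw w0) => //; apply: lip.
exact: (good_admissible markov full).
Qed.

End Distortion.

(** * Induced cocycles *)

Section AlmostDisjoint.
Context (R : realType) (d : measure_display) (X : measurableType d)
  (nu : probability X R) (I : eqType).

(** Cells are disjoint only mod null sets, so each set is added after removing a null overlap. *)
Lemma sum_almost_disjoint_le (s : seq I) (F : I -> set X) (B : set X) :
  uniq s -> measurable B -> (forall i, i \in s -> measurable (F i)) ->
  (forall i, i \in s -> F i `<=` B) ->
  (forall i j, i \in s -> j \in s -> i != j -> nu (F i `&` F j) = 0%E) ->
  \sum_(i <- s) fine (nu (F i)) <= fine (nu B).
Proof.
move=> us mB mF FB dF.
have mU t : {subset t <= s} -> measurable (\big[setU/set0]_(i <- t) F i).
  by move=> ts; rewrite big_seq; apply: bigsetU_measurable => i /ts/mF.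
suff -> : \sum_(i <- s) fine (nu (F i)) = fine (nu (\big[setU/set0]_(i <- s) F i)).
  apply: fine_le; rewrite ?fin_num_measure //; try exact: mU.
  apply: le_measure; rewrite ?inE //; first exact: mU.
  rewrite big_seq; elim/big_ind : _ => // C1 C2 h1 h2.
  by rewrite subUset; split.
elim: s us mF dF mU {FB} => [|i s IH] /=.
  by move=> *; rewrite !big_nil measure0.
move=> /andP[si us] mF dF mU; rewrite !big_cons IH //; last first.
- by move=> t ts; apply: mU => j /ts js; rewrite in_cons js orbT.
- by move=> j k js ks; apply: dF; rewrite in_cons ?js ?ks orbT.
- by move=> j js; apply: mF; rewrite in_cons js orbT.
set U := \big[setU/set0]_(j <- s) F j.
have mUs : measurable U by apply: mU => j js; rewrite in_cons js orbT.
have mFi : measurable (F i) by apply: mF; exact: mem_head.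
have FU0 : nu (F i `&` U) = 0%E.
  apply/negligibleP; first exact: measurableI.
  rewrite /U big_seq; apply: (big_ind (fun B => nu.-negligible (F i `&` B))).
  - by rewrite setI0; exact: negligible_set0.
  - by move=> C1 C2 ? ?; rewrite setIUr; exact: negligibleU.
  move=> j js; apply/negligibleP; first by apply: measurableI => //; apply: mF; rewrite in_cons js orbT.
  apply: dF; rewrite ?mem_head ?in_cons ?js ?orbT //.
  by apply: contraNneq si => ->.
have mD : measurable (U `\` F i) by exact: measurableD.
rewrite (_ : F i `|` U = F i `|` (U `\` F i)); last first.
  by apply/seteqP; split => x; have [] := pselect (F i x); rewrite /setU /setD /=; tauto.
rewrite measureU //; last by rewrite setDIK.
rewrite fineD ?fin_num_measure //; congr (_ + _).
have e : nu U = (nu (U `\` F i) + nu (U `&` F i))%E by exact: measureDI.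
by rewrite e (setIC U) FU0 adde0.
Qed.

End AlmostDisjoint.

Section Cocycles.
Context (X V : Type) (theta : X -> X) (kappa : X -> V -> V).

Lemma cocycle_iter_add m n x g : cocycle_iter theta kappa (m + n) x g =
  cocycle_iter theta kappa n (iter m theta x) (cocycle_iter theta kappa m x g).
Proof.
elim: n => [|n IH] /=; first by rewrite addn0.
by rewrite addnS /= IH addnC iterD.
Qed.

Lemma cocycle_iterS n x g : cocycle_iter theta kappa n.+1 x g =
  cocycle_iter theta kappa n (theta x) (kappa x g).
Proof. by rewrite -add1n cocycle_iter_add. Qed.

Lemma cocycle_iter_inj n x : (forall y, injective (kappa y)) ->
  injective (cocycle_iter theta kappa n x).
Proof. by move=> kI; elim: n => [|n IH] g h //= /kI /IH. Qed.

End Cocycles.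

(** * Measurability and total mass of the return sets *)

Section ReturnSets.
Context (R : realType) (d : measure_display) (X : measurableType d)
  (mu : probability X R) (A : countType) (cell : A -> set X) (theta : X -> X)
  (V : countType) (E : set (V * V)) (kappa : X -> V -> V).
Hypothesis markov : markov_map mu cell theta.
Hypothesis cocycle : nearest_neighbour_cocycle cell E kappa.

Lemma markov_map_measurable : measurable_fun setT theta.
Proof.
have [_ _ cover mm] := markov.
move=> _ B mB; rewrite setTI.
rewrite (_ : _ @^-1` _ = \bigcup_a (cell a `&` theta @^-1` B)).
  apply: countable_bigcup_measurable => a _.
  exact: (mm_preimage_measurable mm).
apply/seteqP; split => [x Bx|x [a _ []] //].
by have : [set: X] x by []; rewrite -cover => -[a _ ax]; exists a.
Qed.

Lemma kappa_set_measurable g h : measurable [set x | kappa x g = h].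
Proof.
have [_ _ cover mm] := markov; have [_ _ cst] := cocycle.
rewrite (_ : [set x | _] =
  \bigcup_(a in [set a | exists2 y, cell a y & kappa y g = h]) cell a).
  by apply: countable_bigcup_measurable => a _; exact: (mm_cell_measurable mm).
apply/seteqP; split => [x xh|x [a [y ay yh] ax]] /=.
  by have : [set: X] x by []; rewrite -cover => -[a _ ax]; exists a => //; exists x.
by rewrite -yh; exact: (cst a).
Qed.

Lemma cocycle_set_measurable n g h :
  measurable [set x | cocycle_iter theta kappa n x g = h].
Proof.
elim: n g h => [|n IH] g h /=.
  have [->|gh] := pselect (g = h).
    by rewrite (_ : [set _ | _] = setT) //; apply/seteqP; split.
  by rewrite (_ : [set _ | _] = set0) //; apply/seteqP; split.
rewrite (_ : [set x | _] = \bigcup_(h' in [set: V])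
  ([set x | cocycle_iter theta kappa n x g = h'] `&`
   iter n theta @^-1` [set x | kappa x h' = h])).
  apply: countable_bigcup_measurable => h' _; apply: measurableI => //.
  have mn : measurable_fun setT (iter n theta).
    elim: n {IH} => [|n IHn]; first exact: measurable_id.
    exact: (measurableT_comp markov_map_measurable IHn).
  by rewrite -[X in measurable X]setTI; apply: mn => //; exact: kappa_set_measurable.
apply/seteqP; split => [x xh|x [h' _ [/= <-]] //].
by exists (cocycle_iter theta kappa n x g).
Qed.

(** The start varies and the target is fixed: injectivity of the fibre maps sends at most one [g] to
    [v] over each point, so the sets are disjoint. *)
Lemma sum_return_le (nu : probability X R) n v (s : seq V) : uniq s ->
  \sum_(g <- s) fine (nu [set x | cocycle_iter theta kappa n x g = v]) <= 1.
Proof.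
have [bij _ _] := cocycle.
move=> us; have -> : 1 = fine (nu setT) by rewrite probability_setT.
apply: sum_almost_disjoint_le => // [g _|g h _ _ gh].
  exact: cocycle_set_measurable.
rewrite (_ : _ `&` _ = set0) ?measure0 //; apply/seteqP; split => // x [/= gv hv].
have : g = h by apply: (@cocycle_iter_inj _ _ theta kappa n x) => [y|]; [exact: bij_inj | rewrite gv].
by move/eqP; rewrite (negbTE gh).
Qed.

End ReturnSets.

(** * Coding of induced orbits by words over [beta] *)

Section InducedWords.
Context (R : realType) (d : measure_display) (X : measurableType d)
  (A : countType) (cell : A -> set X) (theta : X -> X)
  (beta : set (seq A)) (eta : seq A -> nat) (V : countType)
  (kappa : X -> V -> V).
Local Notation bcell := (cyl cell theta).
Local Notation sigma := (induced_map cell theta beta eta).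
Local Notation khat := (induced_cocycle cell theta beta eta kappa).
Local Notation good w := (forall u, u \in w -> beta u).
Implicit Types (u : seq A) (w : seq (seq A)).

(** The choice of the point is immaterial once the induced cocycle is constant on cells, see
    [letter_actionE]. *)
Definition letter_action u : V -> V := khat (xget point (bcell u)).

Definition word_time w : nat := (\sum_(u <- w) eta u)%N.

(* Unlike [cyl bcell sigma w], these sets record the symbols by which [sigma] is
   defined. *)
Fixpoint symbol_cyl w : set X :=
  if w is u :: w' then
    [set x | symbol beta bcell x = Some u /\ symbol_cyl w' (sigma x)]
  else setT.

Lemma symbol_some x u : symbol beta bcell x = Some u -> beta u /\ bcell u x.
Proof.
by rewrite /symbol; case: pselect => // h [<-]; exact: (svalP (cid h)).
Qed.

Lemma symbol_ex x : induced_domain cell theta beta x ->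
  exists u, symbol beta bcell x = Some u.
Proof.
move=> [u bu ux]; rewrite /symbol; case: pselect => [h|[]]; last by exists u.
by exists (sval (cid h)).
Qed.

Lemma symbol_cyl_sub w x : symbol_cyl w x ->
  good w /\ cyl bcell sigma w x.
Proof.
elim: w x => [|u w IH] x //= [/symbol_some[bu ux] /IH[gw wx]]; split => // v.
by rewrite in_cons => /predU1P[->//|/gw].
Qed.

Lemma symbol_cylE w x g : symbol_cyl w x ->
  iter (size w) sigma x = iter (word_time w) theta x /\
  cocycle_iter sigma khat (size w) x g =
  cocycle_iter theta kappa (word_time w) x g.
Proof.
rewrite /word_time; elim: w x g => [|u w IH] x g; first by rewrite big_nil.
rewrite big_cons /= => -[xu /IH ih].
have tx : inducing_time cell theta beta eta x = eta u.
  by rewrite /inducing_time xu.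
have sx : sigma x = iter (eta u) theta x by rewrite /induced_map tx.
have [e1 e2] := ih (khat x g).
rewrite -iterS iterSr e1 sx -iterD addnC; split => //.
rewrite -/(cocycle_iter sigma khat (size w).+1 x g) cocycle_iterS e2.
by rewrite cocycle_iter_add sx /induced_cocycle tx.
Qed.

Lemma symbol_cyl_ae (nu : probability X R) n :
  markov_map_mod nu beta bcell sigma ->
  nu.-negligible [set x | ~ exists2 w, size w = n & symbol_cyl w x].
Proof.
move=> mm; elim: n => [|n IH].
  rewrite (_ : [set x | _] = set0); first exact: negligible_set0.
  by apply/seteqP; split => [x h|//]; exfalso; apply: h; exists [::].
apply: (@negligibleS _ _ _ _ (~` (\bigcup_(u in beta) bcell u) `|`
  \bigcup_(u in beta) (bcell u `&` sigma @^-1`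
    [set x | ~ exists2 w, size w = n & symbol_cyl w x]))).
  move=> x nx; have [xd|xd] := pselect (induced_domain cell theta beta x); last by left.
  have [u xu] := symbol_ex xd; have [bu ux] := symbol_some xu.
  right; exists u => //; split => //= -[w wn wx]; apply: nx.
  by exists (u :: w); rewrite /= ?wn.
apply: negligibleU.
  apply/negligibleP; last exact: (mm_cover mm).
  apply: measurableC; apply: countable_bigcup_measurable => u.
  exact: (mm_cell_measurable mm).
apply: negligible_countable_bigcup => u bu.
exact: (preimage_null mm).
Qed.

Lemma letter_action_inj u : (forall x, injective (kappa x)) ->
  injective (letter_action u).
Proof. by move=> kI; exact: cocycle_iter_inj. Qed.

Hypothesis khat_cst : cellwise_constant khat beta bcell.

Lemma letter_actionE u x g : beta u -> bcell u x -> khat x g = letter_action u g.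
Proof.
move=> bu ux; apply: (khat_cst g bu ux).
exact: (xgetPex point (ex_intro _ x ux)).
Qed.

Lemma cocycle_iter_act w x g : good w -> cyl bcell sigma w x ->
  cocycle_iter sigma khat (size w) x g = act letter_action w g.
Proof.
elim: w x g => [//|u w IH] x g gw [ux wx].
have [bu {}gw] := good_cons gw.
by rewrite cocycle_iterS IH //= (letter_actionE g bu ux).
Qed.

End InducedWords.

(** * Exponential rates *)

Section ExponentialDecay.
Context (R : realType).

Lemma bernoulli_le (h : R) n : -1 <= h -> 1 + n%:R * h <= (1 + h) ^+ n.
Proof.
move=> h1; elim: n => [|n IH]; first by rewrite mul0r addr0.
rewrite exprS; apply: (@le_trans _ _ ((1 + h) * (1 + n%:R * h))).
  rewrite -natr1 -subr_ge0 (_ : _ - _ = n%:R * h ^+ 2); last by ring.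
  by rewrite mulr_ge0 ?sqr_ge0.
by rewrite ler_wpM2l //; lra.
Qed.

Lemma exists_exp_ge (x C : R) : 1 < x ->
  exists N, forall n, (N <= n)%N -> C <= x ^+ n.
Proof.
move=> x1; pose h := x - 1; have h0 : 0 < h by rewrite subr_gt0.
exists (Num.bound `|C / h|) => n Nn.
have := @bernoulli_le h n; rewrite (_ : 1 + h = x); last by rewrite /h; ring.
have h1 : -1 <= h by apply: le_trans (ltW h0); rewrite lerN10.
move=> /(_ h1); apply: le_trans.
apply: (@le_trans _ _ (n%:R * h)); last by rewrite lerDr.
rewrite -ler_pdivrMr //; apply: (le_trans (ler_norm _)).
apply: (le_trans (ltW (archi_boundP (normr_ge0 _)))).
by rewrite ler_nat.
Qed.

Lemma exists_root_ge (t : R) q : 0 <= t < 1 -> (0 < q)%N ->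
  exists2 y : R, 0 < y < 1 & t <= y ^+ q.
Proof.
move=> /andP[t0 t1] q0; have q0' : 0 < q%:R :> R by rewrite ltr0n.
have q1 : 1 <= q%:R :> R by rewrite ler1n.
(* With this [e], Bernoulli's inequality gives [(1 - e) ^+ q >= (1 + t) / 2], so no exact root is
   needed and [t = 0] is allowed. *)
pose e := (1 - t) / (2 * q%:R).
have e0 : 0 < e by rewrite divr_gt0 ?mulr_gt0 // subr_gt0.
have e1 : e < 1 by rewrite ltr_pdivrMr ?mulr_gt0 //; lra.
exists (1 - e); first by apply/andP; split; lra.
apply: (@le_trans _ _ (1 + q%:R * - e)); last first.
  by apply: bernoulli_le; rewrite lerN2 ltW.
rewrite (_ : q%:R * - e = - ((1 - t) / 2)); first by lra.
by rewrite /e; field; rewrite gt_eqF.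
Qed.

Lemma exp_decay_combine (b : nat -> R) (z L t D : R) r :
  1 < z -> 1 <= L -> 0 <= t < 1 -> 0 <= D -> (0 < r)%N ->
  (forall n K, b n <= L ^+ K / z ^+ n + D * n.+1%:R * t ^+ (K %/ r)) ->
  exists2 l : R, 0 < l < 1 &
    exists N, forall n, (N <= n)%N -> b n <= l ^+ n.
Proof.
move=> z1 L1 t01 D0 r0 bP.
have z0 : 0 < z by apply: lt_trans z1.
(* One factor [z' ^- n] pays for [L ^+ K] with [K = n %/ m]; the other is left as decay. *)
pose z' := Num.sqrt z; have z'0 : 0 < z' by rewrite sqrtr_gt0.
have z'z : z' ^+ 2 = z by rewrite sqr_sqrtr ?ltW.
have z'1 : 1 < z' by rewrite -(@ltr_pXn2r _ 2) ?nnegrE ?ltW // expr1n z'z.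
have [m [m0 Lm]] : exists m, (0 < m)%N /\ L <= z' ^+ m.
  have [N NP] := exists_exp_ge L z'1; exists N.+1; split => //.
  exact/NP/leqnSn.
have mr0 : (0 < m * r)%N by rewrite muln_gt0 m0.
have [y /andP[y0 y1] ty] := exists_root_ge t01 mr0.
have /andP[t0 _] := t01.
pose l1 := Num.max z'^-1 y.
have l10 : 0 < l1 by rewrite lt_max y0 orbT.
have l11 : l1 < 1 by rewrite gt_max y1 andbT invf_lt1.
have first n : L ^+ (n %/ m) / z ^+ n <= l1 ^+ n.
  apply: (@le_trans _ _ ((z'^-1) ^+ n)); last first.
    by rewrite lerXn2r ?nnegrE ?invr_ge0 ?(ltW z'0) ?(ltW l10) // le_max lexx.
  rewrite ler_pdivrMr ?exprn_gt0 // -z'z -exprMn expr2 mulKf ?gt_eqF //.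
  apply: (@le_trans _ _ ((z' ^+ m) ^+ (n %/ m))).
    by rewrite lerXn2r ?nnegrE ?exprn_ge0 ?(ltW z'0) // (le_trans _ L1).
  by rewrite -exprM ler_weXn2l ?(ltW z'1) // mulnC leq_trunc_div.
(* Rounding in the two divisions costs at most the constant [y ^- (m * r)]. *)
have second n : t ^+ (n %/ m %/ r) <= l1 ^+ n / y ^+ (m * r).
  rewrite -divnMA ler_pdivlMr ?exprn_gt0 //.
  apply: (@le_trans _ _ ((y ^+ (m * r)) ^+ (n %/ (m * r)) * y ^+ (m * r))).
    by rewrite ler_wpM2r ?exprn_ge0 ?(ltW y0) // lerXn2r ?nnegrE ?exprn_ge0 // ltW.
  rewrite -exprM -exprD; apply: (@le_trans _ _ (y ^+ n)).
    apply: ler_wiXn2l; rewrite ?(ltW y0) ?(ltW y1) //.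
    by rewrite -mulnSr mulnC ltnW // ltn_ceil.
  by rewrite lerXn2r ?nnegrE ?(ltW y0) ?(ltW l10) // le_max lexx orbT.
pose C := 1 + D / y ^+ (m * r).
have C0 : 0 <= C by rewrite addr_ge0 // divr_ge0 // exprn_ge0 // ltW.
have b1 n : b n <= C * n.+1%:R * l1 ^+ n.
  apply: (le_trans (bP n (n %/ m)%N)).
  have n1 : 1 <= n.+1%:R :> R by rewrite ler1n.
  rewrite (_ : C * _ * _ = n.+1%:R * l1 ^+ n +
    D * n.+1%:R * (l1 ^+ n / y ^+ (m * r))); last by rewrite /C; ring.
  apply: lerD.
    by apply: (le_trans (first n)); rewrite ler_peMl // exprn_ge0 // ltW.
  by rewrite ler_wpM2l // mulr_ge0.
(* The passage from [l1] to [l2] absorbs [n + 1], since [n + 1 <= (1 + h^-1) * (1 + h) ^+ n]; [l3]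
   then absorbs the constant. *)
pose l2 := (1 + l1) / 2; pose h := l2 / l1 - 1.
have l20 : 0 < l2 by rewrite /l2; lra.
have l21 : l2 < 1 by rewrite /l2; lra.
have h0 : 0 < h by rewrite subr_gt0 ltr_pdivlMr // mul1r /l2; lra.
have b2 n : b n <= C * (1 + h^-1) * l2 ^+ n.
  apply: (le_trans (b1 n)); rewrite -!mulrA ler_wpM2l //.
  have -> : l2 ^+ n = (1 + h) ^+ n * l1 ^+ n.
    by rewrite -exprMn; congr (_ ^+ n); rewrite /h; field; rewrite gt_eqF.
  rewrite mulrA ler_wpM2r ?exprn_ge0 ?(ltW l10) //.
  apply: (@le_trans _ _ ((1 + h^-1) * (1 + n%:R * h))).
    rewrite -natr1 (_ : (1 + h^-1) * _ = n%:R + 1 + (n%:R * h + h^-1)).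
      by rewrite lerDl addr_ge0 ?mulr_ge0 ?invr_ge0 ?(ltW h0).
    by field; rewrite gt_eqF.
  rewrite ler_wpM2l //; first by rewrite addr_ge0 // invr_ge0 ltW.
  by apply: bernoulli_le; lra.
pose l3 := (1 + l2) / 2.
have l32 : 1 < l3 / l2 by rewrite ltr_pdivlMr // mul1r /l3; lra.
have [N NP] := exists_exp_ge (C * (1 + h^-1)) l32.
exists l3; first by apply/andP; split; rewrite /l3; lra.
exists N => n /NP; rewrite expr_div_n ler_pdivlMr ?exprn_gt0 //.
exact: le_trans.
Qed.

Lemma exponential_moment (T : eqType) (P : T -> Prop) (w : T -> R)
    (e : T -> nat) (c l : R) :
  (forall u, 0 <= w u) -> 0 <= c -> 0 < l < 1 ->
  (forall n (s : seq T), uniq s -> (forall u, u \in s -> P u) ->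
    (forall u, u \in s -> e u = n) -> \sum_(u <- s) w u <= c * l ^+ n) ->
  exists2 z : R, 1 < z & exists2 M : R, 0 <= M &
    forall s : seq T, uniq s -> (forall u, u \in s -> P u) ->
    \sum_(u <- s) w u * z ^+ e u <= M.
Proof.
move=> w0 c0 /andP[l0 l1] wc.
(* Chosen so that [1 < z] and [z * l < 1]: the moment is then dominated by a geometric series. *)
pose z := 2 / (1 + l).
have z1 : 1 < z by rewrite ltr_pdivlMr; lra.
have zl1 : z * l < 1 by rewrite /z mulrAC ltr_pdivrMr; lra.
have zl0 : 0 <= z * l by rewrite mulr_ge0 // ltW // (lt_trans _ z1).
exists z => //; exists (c / (1 - z * l)).
  by rewrite divr_ge0 // subr_ge0 ltW.
move=> s us sP; pose B := (\max_(u <- s) e u).+1.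
have -> : \sum_(u <- s) w u * z ^+ e u =
    \sum_(i < B) z ^+ i * \sum_(u <- s | e u == i) w u.
  under [RHS]eq_bigr do rewrite mulr_sumr big_mkcond.
  rewrite exchange_big /= big_seq [RHS]big_seq; apply: eq_bigr => u us'.
  have uB : (e u < B)%N by rewrite ltnS; exact: leq_bigmax_seq.
  rewrite (bigD1 (Ordinal uB)) //= eqxx big1 ?addr0 1?mulrC // => i.
  by rewrite -val_eqE /= eq_sym => /negbTE ->.
apply: (@le_trans _ _ (\sum_(i < B) c * (z * l) ^+ i)).
  apply: ler_sum => i _; rewrite [(z * l) ^+ i]exprMn [leRHS]mulrCA ler_wpM2l //.
    by rewrite exprn_ge0 // ltW // (lt_trans _ z1).
  rewrite -big_filter; apply: wc; first by rewrite filter_uniq.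
    by move=> u; rewrite mem_filter => /andP[_ /sP].
  by move=> u; rewrite mem_filter => /andP[/eqP].
rewrite -mulr_sumr ler_wpM2l // -[leRHS]mul1r ler_pdivlMr ?subr_gt0 //.
rewrite mulrC -opprB mulNr -subrX1 opprB gerBl exprn_ge0 //.
Qed.

Local Open Scope ereal_scope.

Lemma poweR_root_le (b l : R) n : (0 <= b)%R -> (0 <= l)%R -> (0 < n)%N ->
  (b%:E `^ n%:R^-1 <= l%:E) = (b <= l ^+ n)%R.
Proof.
move=> b0 l0 n0; rewrite poweR_EFin lee_fin.
have n0' : (n%:R != 0 :> R)%R by rewrite pnatr_eq0 -lt0n.
rewrite -(@ler_pXn2r _ n) ?nnegrE ?powR_ge0 //.
by rewrite -(@powR_mulrn _ (b `^ n%:R^-1)%R) ?powR_ge0 // -powRrM mulVf // powRr1.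
Qed.

Lemma limn_esup_root_lt (b : nat -> R) : (forall n, 0 <= b n)%R ->
  limn_esup (fun n => (b n)%:E `^ n%:R^-1) < 1 ->
  exists2 l : R, (0 < l < 1)%R &
    exists N, forall n, (N <= n)%N -> (b n <= l ^+ n)%R.
Proof.
move=> b0 /ereal_inf_lt[_ [V [N _ NV] <-] s1].
set s := ereal_sup _ in s1.
have ubs n : (N <= n)%N -> (b n)%:E `^ n%:R^-1 <= s.
  by move=> /NV Vn; apply: ereal_sup_ubound; exists n.
have s0 : 0 <= s by apply: le_trans (ubs N (leqnn _)); exact: poweR_ge0.
have sfin : s \is a fin_num by rewrite ge0_fin_numE // (lt_trans s1) // ltey.
(* The supremum may be zero, while a positive rate is wanted. Below, [N.+1] excludes [n = 0], where
   the exponent [n%:R^-1] is zero. *)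
exists (Num.max (fine s) 2^-1)%R.
  rewrite lt_max invr_gt0 ltr0n orbT /= gt_max invf_lt1 ?ltr1n // andbT.
  by rewrite -lte_fin fineK.
exists N.+1 => n Nn; rewrite -poweR_root_le //.
- apply: (le_trans (ubs n (ltnW Nn))).
  by rewrite -(fineK sfin) lee_fin le_max lexx.
- by rewrite le_max invr_ge0 ler0n orbT.
- exact: leq_trans Nn.
Qed.

Lemma limn_esup_root_neq1 (b : nat -> R) (l : R) N : (forall n, 0 <= b n)%R ->
  (0 < l < 1)%R -> (forall n, (N <= n)%N -> (b n <= l ^+ n)%R) ->
  limn_esup (fun n => (b n)%:E `^ n%:R^-1) < 1.
Proof.
move=> b0 /andP[l0 l1] bl; apply: (@le_lt_trans _ _ l%:E); last by rewrite lte_fin.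
apply: (@le_trans _ _ (ereal_sup [set (b n)%:E `^ n%:R^-1 | n in [set n | (N.+1 <= n)%N]])).
  apply: ereal_inf_lbound; exists [set n | (N.+1 <= n)%N] => //.
  by exists N.+1.
apply: ub_ereal_sup => _ [n /= Nn <-].
rewrite poweR_root_le ?(ltW l0) //; last exact: leq_trans Nn.
by apply: bl; exact: ltnW.
Qed.

End ExponentialDecay.

(** * Return probabilities *)

Section ReturnDecay.
Context (R : realType) (d : measure_display) (X : measurableType d)
  (mu : probability X R) (A : countType) (cell : A -> set X) (theta : X -> X)
  (V : countType) (E : set (V * V)) (kappa : X -> V -> V)
  (Omega : set X) (beta : set (seq A)) (eta : seq A -> nat)
  (nu : probability X R) (r : R).
Local Notation bcell := (cyl cell theta).
Local Notation sigma := (induced_map cell theta beta eta).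
Local Notation khat := (induced_cocycle cell theta beta eta kappa).
Local Notation good w := (forall u, u \in w -> beta u).
Local Notation p w := (fine (nu (cyl bcell sigma w))).
Local Notation kk := (letter_action cell theta beta eta kappa).
Implicit Types (w : seq (seq A)) (u : seq A).

Hypothesis markov : markov_map mu cell theta.
Hypothesis cocycle : nearest_neighbour_cocycle cell E kappa.
Hypothesis r01 : 0 < r < 1.
Hypothesis egm : embedded_gibbs_markov mu cell theta Omega beta eta nu r.
Hypothesis khat_cst : cellwise_constant khat beta bcell.

Let mm : markov_map_mod nu beta bcell sigma.
Proof. by have [] := egm_gibbs_markov egm. Qed.

Let fin_nu B : measurable B -> nu B \is a fin_num.
Proof. exact: fin_num_measure. Qed.

Lemma Omega_measurable : measurable Omega.
Proof.
have [_ _ _ mmX] := markov; have [J _ ->] := egm_finite_union egm.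
by apply: countable_bigcup_measurable => a _; exact: (mm_cell_measurable mmX).
Qed.

Lemma restriction_ge B : measurable B ->
  fine (mu (Omega `&` B)) <= fine (nu B) /\
  fine (nu B) = (fine (mu Omega))^-1 * fine (mu (Omega `&` B)).
Proof.
move=> mB; have mO := Omega_measurable.
have mOB : measurable (Omega `&` B) by exact: measurableI.
have fO := fin_num_measure mu _ mO; have fOB := fin_num_measure mu _ mOB.
have O0 : 0 < fine (mu Omega) by rewrite -lte_fin fineK // (egm_pos egm).
have O1 : fine (mu Omega) <= 1 by rewrite -lee_fin fineK // probability_le1.
have e : fine (nu B) = (fine (mu Omega))^-1 * fine (mu (Omega `&` B)).
  by rewrite (egm_nu egm mB) setIC -(fineK fOB).
split => //; rewrite e ler_peMl ?invf_ge1 //.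
by apply: fine_ge0; exact: measure_ge0.
Qed.

Lemma inducing_time_decay : exponential_decay mu cell theta Omega beta eta ->
  exists2 c : R, 0 <= c & exists2 l : R, 0 < l < 1 &
  forall n (s : seq (seq A)), uniq s -> good s ->
    (forall u, u \in s -> eta u = n) -> \sum_(u <- s) fine (nu (bcell u)) <= c * l ^+ n.
Proof.
rewrite /exponential_decay.
pose H n := \bigcup_(u in [set u | beta u /\ eta u = n]) bcell u.
have mH n : measurable (H n).
  by apply: countable_bigcup_measurable => u [bu _]; exact: (mm_cell_measurable mm).
have HE n : [set x | Omega x /\ exists u, [/\ beta u, bcell u x & eta u = n]] =
    Omega `&` H n.
  apply/seteqP; split => x [Ox]; last by move=> [u [bu un] ux]; split => //; exists u.
  by move=> [u [bu ux un]]; split => //; exists u.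
have mOH n : measurable (Omega `&` H n) by exact: measurableI Omega_measurable _.
under eq_fun do rewrite HE -(fineK (fin_num_measure mu _ (mOH _))).
move=> /limn_esup_root_lt[|l l01 [N bl]].
  by move=> n; apply: fine_ge0; exact: measure_ge0.
have /andP[l0 l1] := l01.
pose m0 := (fine (mu Omega))^-1.
have m00 : 0 <= m0 by rewrite invr_ge0 fine_ge0.
have lN0 : 0 <= l ^- N by rewrite invr_ge0 exprn_ge0 // ltW.
(* [m0] passes from [mu] to [nu] when [n >= N]; for smaller [n], [l ^- N] turns the trivial bound 1
   into a multiple of [l ^+ n]. *)
exists (m0 + l ^- N); first exact: addr_ge0.
exists l => // n s us gs es.
have sH : \sum_(u <- s) fine (nu (bcell u)) <= fine (nu (H n)).
  apply: sum_almost_disjoint_le => // [u us'|u us' x ux|u v us' vs].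
  - exact/(mm_cell_measurable mm)/gs.
  - by exists u => //; split; [exact: gs | exact: es].
  - by apply: (mm_disjoint mm); exact: gs.
apply: (le_trans sH); rewrite mulrDl.
have ln0 : 0 <= l ^+ n by rewrite exprn_ge0 // ltW.
have [Nn|nN] := leqP N n.
  have [_ ->] := restriction_ge (mH n).
  apply: (@le_trans _ _ (m0 * l ^+ n)); last by rewrite lerDl mulr_ge0.
  by rewrite ler_wpM2l // bl.
apply: (@le_trans _ _ 1); first by rewrite -lee_fin fineK ?fin_nu // probability_le1.
apply: (@le_trans _ _ (l ^- N * l ^+ n)); last by rewrite lerDr mulr_ge0.
rewrite mulrC ler_pdivlMr ?exprn_gt0 // mul1r.
by rewrite ler_wiXn2l ?(ltW l0) ?(ltW l1) // ltnW.
Qed.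

Lemma word_measurable w : good w -> measurable (cyl bcell sigma w).
Proof. exact: (cyl_measurable mm). Qed.

Let D_ex : exists2 D : R, 1 <= D & forall w B, good w -> measurable B ->
  fine (nu (cyl bcell sigma w `&` iter (size w) sigma @^-1` B)) <=
    D * (p w * fine (nu B)) /\
  p w * fine (nu B) <=
    D * fine (nu (cyl bcell sigma w `&` iter (size w) sigma @^-1` B)).
Proof.
have full : full_branches nu beta bcell sigma by have [] := egm_gibbs_markov egm.
have [D D1 DP] := gibbs_quasi_bernoulli mm full r01 (egm_gibbs_markov egm).
exists D => // w B gw mB; have := DP w B gw mB.
rewrite -(fineK (fin_nu mB)) -(fineK (fin_nu (word_measurable gw))).
rewrite -(fineK (fin_nu (cyl_preimage_measurable mm gw mB))).
by rewrite -!EFinM !lee_fin.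
Qed.

Lemma sum_rcons_le w s : good w -> good s -> uniq s ->
  \sum_(u <- s) p (rcons w u) <= p w.
Proof.
move=> gw gs us.
have gr u : u \in s -> good (rcons w u).
  by move=> us' v; rewrite mem_rcons in_cons => /predU1P[->|/gw //]; exact: gs.
apply: sum_almost_disjoint_le => //.
- exact: word_measurable.
- by move=> u us'; apply: word_measurable; exact: gr.
- by move=> u us'; rewrite -cats1 cyl_cat => x [].
move=> u v us' vs uv; apply/negligibleP.
  by apply: measurableI; apply: word_measurable; exact: gr.
have nuv : nu.-negligible (bcell u `&` bcell v).
  apply/negligibleP; last by apply: (mm_disjoint mm) => //; exact: gs.
  by apply: measurableI; apply: (mm_cell_measurable mm); exact: gs.
apply: negligibleS (cyl_preimage_null mm gw nuv).
by rewrite -!cats1 !cyl_cat /= => x [[wx [ux _]] [_ [vx _]]].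
Qed.

Hypothesis time_decay : exponential_decay mu cell theta Omega beta eta.
Variables (S : seq (seq A)) (q : R).
Hypothesis S_uniq : uniq S.
Hypothesis S_good : good S.
Hypothesis S_gt0 : (0 < size S)%N.
Hypothesis q01 : 0 <= q < 1.
Hypothesis gap : forall (f : V -> R) m, (forall g, 0 <= f g) -> l2_le f m ->
  l2_le (fun g => \sum_(b <- S) f (kk b g)) ((size S)%:R * q * m).

Let kappa_inj x : injective (kappa x).
Proof. by have [bij _ _] := cocycle; exact: bij_inj. Qed.

(** For every number [K] of induced steps, the first term bounds the event that these steps last
    longer than [n], the second a return after them. [K] stays free and is optimized in
    [exp_decay_combine]. *)
Lemma return_bound v : exists z L t D : R, exists k : nat,
  [/\ 1 < z, 1 <= L, 0 <= t < 1, 0 <= D & (0 < k)%N] /\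
  forall n K, fine (nu [set x | cocycle_iter theta kappa n x v = v]) <=
    L ^+ K / z ^+ n + D * n.+1%:R * t ^+ (K %/ k).
Proof.
have [D D1 DP] := D_ex.
have D0 : 0 < D by exact: lt_le_trans ltr01 D1.
have p_ge0 w : 0 <= p w by apply: fine_ge0; exact: measure_ge0.
have p_nil : p [::] = 1 by rewrite /= probability_setT.
have p1 u : beta u -> cyl bcell sigma [:: u] = bcell u.
  by move=> bu; rewrite /= preimage_setT setIT.
have p_cat_le w1 w2 : good w1 -> good w2 -> p (w1 ++ w2) <= D * (p w1 * p w2).
  move=> g1 g2; rewrite cyl_cat.
  by have [] := DP w1 _ g1 (word_measurable g2).
have p_cat_ge w1 w2 : good w1 -> good w2 -> p w1 * p w2 <= D * p (w1 ++ w2).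
  move=> g1 g2; rewrite cyl_cat.
  by have [] := DP w1 _ g1 (word_measurable g2).
have p_gt0 w : good w -> 0 < p w.
  elim: w => [|u w IH] gw; first by rewrite p_nil.
  have [bu gw'] := good_cons gw.
  have gu : good [:: u] by move=> v'; rewrite inE => /eqP ->.
  have := p_cat_ge [:: u] w gu gw'; rewrite cat1s p1 // => h.
  rewrite -(pmulr_rgt0 _ D0); apply: lt_le_trans h; rewrite mulr_gt0 ?IH //.
  by rewrite -lte_fin fineK ?(mm_cell_pos mm) // fin_nu //; exact: (mm_cell_measurable mm).
have kk_inj u : injective (kk u) by exact: letter_action_inj.
have [k [t [k0 t01 decay]]] := word_sum_decay kk_inj p_ge0 p_nil p_gt0 D0
  p_cat_le p_cat_ge sum_rcons_le S_uniq S_good S_gt0 q01 gap.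
have [c c0 [l l01 cl]] := inducing_time_decay time_decay.
have [z z1 [M M0 zM]] := exponential_moment
  (fun u => fine_ge0 (measure_ge0 nu (bcell u))) c0 l01 cl.
have z0 : 0 < z by exact: lt_trans z1.
(* Quasi-independence multiplies the moments of the single inducing times, at the cost of one factor
   [D] per letter. *)
have moment s n : good s -> uniq s ->
    \sum_(w <- words s n) p w * z ^+ word_time eta w <= (D * M) ^+ n.
  move=> gs us; elim: n => [|n IH].
    by rewrite big_seq1 p_nil /word_time big_nil mulr1.
  rewrite big_allpairs_dep exprS.
  apply: (@le_trans _ _ (\sum_(u <- s) D * (fine (nu (bcell u)) * z ^+ eta u) *
      \sum_(w <- words s n) p w * z ^+ word_time eta w)).
    rewrite big_seq [leRHS]big_seq; apply: ler_sum => u us'.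
    rewrite mulr_sumr big_seq [leRHS]big_seq; apply: ler_sum => w.
    rewrite mem_words => /andP[_ /allP ws].
    have gu : good [:: u] by move=> v'; rewrite inE => /eqP ->; exact: gs.
    have gw : good w by move=> v' /ws; exact: gs.
    rewrite /word_time big_cons exprD -/(word_time eta w).
    have := p_cat_le [:: u] w gu gw; rewrite cat1s p1; last exact: gs.
    move=> h; rewrite [leRHS](_ : _ = D * (fine (nu (bcell u)) * p w) *
       (z ^+ eta u * z ^+ word_time eta w)); last by ring.
    by rewrite ler_wpM2r // mulr_ge0 // exprn_ge0 // ltW.
  rewrite -mulr_suml -mulr_sumr; apply: ler_pM => //.
  - rewrite mulr_ge0 ?(ltW D0) // sumr_ge0 // => u _.
    by rewrite mulr_ge0 ?exprn_ge0 ?(ltW z0) ?fine_ge0.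
  - by rewrite sumr_ge0 // => w _; rewrite mulr_ge0 ?exprn_ge0 ?(ltW z0).
  - by rewrite ler_wpM2l ?(ltW D0) ?zM.
pose L := Num.max 1 (D * M).
have L1 : 1 <= L by rewrite le_max lexx.
exists z, L, t, D, k; split; first by split => //; exact: ltW.
move=> n K.
(* The remaining [j] steps, started afresh from [g]. Values at most 1 with sum at most 1 give an l^2
   norm at most 1. *)
pose f j g : R := fine (nu [set x | cocycle_iter theta kappa j x g = v]).
have mf j g : measurable [set x | cocycle_iter theta kappa j x g = v].
  exact: (cocycle_set_measurable markov cocycle).
have f0 j g : 0 <= f j g by rewrite fine_ge0.
have f1 j : l2_le (f j) 1.
  move=> s us; rewrite expr1n; apply: le_trans (sum_return_le markov cocycle nu j v us).
  apply: ler_sum => g _; rewrite expr2 ler_piMl // -lee_fin fineK ?fin_nu //.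
  exact: probability_le1.
pose F w := if (n < word_time eta w)%N then cyl bcell sigma w else
  cyl bcell sigma w `&` iter (size w) sigma @^-1`
    [set y | cocycle_iter theta kappa (n - word_time eta w) y (act kk w v) = v].
have mF w : good w -> measurable (F w).
  move=> gw; rewrite /F; case: ifP => _; first exact: word_measurable.
  exact: (cyl_preimage_measurable mm).
(* Words lasting too long are bounded by the exponential Chebyshev inequality. For the others the
   remaining time varies with [w]; summing over all [j] lets [decay] be applied to one fixed [f j]
   at a time. *)
have FP w : good w -> fine (nu (F w)) <= p w * z ^+ word_time eta w / z ^+ n +
    \sum_(j < n.+1) D * (p w * f j (act kk w v)).
  move=> gw; rewrite /F; have [nw|wn] := ltnP n (word_time eta w).
    apply: (@le_trans _ _ (p w * z ^+ word_time eta w / z ^+ n)).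
      rewrite -mulrA ler_peMr // ler_pdivlMr ?exprn_gt0 // mul1r.
      by rewrite ler_weXn2l ?(ltW z1) // ltnW.
    by rewrite lerDl sumr_ge0 // => j _; rewrite !mulr_ge0 // ltW.
  have [h _] := DP w _ gw (mf (n - word_time eta w)%N (act kk w v)).
  apply: (le_trans h); have jn : (n - word_time eta w < n.+1)%N by rewrite ltnS leq_subr.
  rewrite (bigD1 (Ordinal jn)) //= addrCA lerDl addr_ge0 //.
    by rewrite mulr_ge0 ?invr_ge0 ?exprn_ge0 ?mulr_ge0 ?exprn_ge0 // ltW.
  by rewrite sumr_ge0 // => j _; rewrite !mulr_ge0 // ltW.
apply: (measure_countable_cover_le (P := [set w | size w = K /\ good w]) (F := F)
  (mf n v) (symbol_cyl_ae K mm)).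
- by move=> w [_ gw]; exact: mF.
- move=> x xv.
  have [[w wK wx]|nw] := pselect (exists2 w, size w = K &
    symbol_cyl cell theta beta eta w x); last by left.
  have [gw cx] := symbol_cyl_sub wx.
  right; exists w => //; rewrite /F; case: ltnP => // wn; split => //=.
  have [e1 e2] := symbol_cylE kappa v wx.
  by rewrite -(cocycle_iter_act khat_cst v gw cx) e2 e1 -cocycle_iter_add subnKC.
move=> T uT PT.
(* A finite alphabet for the words of [T], enlarged by [S] so that the uniform contraction
   applies. *)
pose s := undup (S ++ flatten T).
have us : uniq s by exact: undup_uniq.
have gs : good s.
  move=> u; rewrite mem_undup mem_cat => /orP[/S_good //|/flattenP[w wT uw]].
  by have [_ gw] := PT w wT; exact: gw.
have Ss : {subset S <= s} by move=> u uS; rewrite /s mem_undup mem_cat uS.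
have Ts : {subset T <= words s K}.
  move=> w wT; rewrite mem_words; have [-> _] := PT w wT; rewrite eqxx /=.
  apply/allP => u uw; rewrite /s inE mem_undup mem_cat; apply/orP; right.
  by apply/flattenP; exists w.
apply: (@le_trans _ _ (\sum_(w <- words s K)
    (p w * z ^+ word_time eta w / z ^+ n +
     \sum_(j < n.+1) D * (p w * f j (act kk w v))))).
  apply: (@le_trans _ _ (\sum_(w <- T)
    (p w * z ^+ word_time eta w / z ^+ n +
     \sum_(j < n.+1) D * (p w * f j (act kk w v))))).
    rewrite big_seq [leRHS]big_seq; apply: ler_sum => w wT.
    by apply: FP; have [] := PT w wT.
  apply: ler_sum_uniq_subset => //; first exact: words_uniq.
  move=> w; rewrite addr_ge0 //.
    by rewrite !mulr_ge0 ?invr_ge0 ?exprn_ge0 // ltW.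
  by rewrite sumr_ge0 // => j _; rewrite !mulr_ge0 // ltW.
rewrite big_split /=; apply: lerD.
  rewrite -mulr_suml ler_wpM2r ?invr_ge0 ?exprn_ge0 ?(ltW z0) //.
  apply: (le_trans (moment s K gs us)).
  by rewrite lerXn2r ?nnegrE ?mulr_ge0 ?(ltW D0) // ?(le_trans ler01 L1) // le_max lexx orbT.
rewrite exchange_big /= -mulrA mulrCA mulr_natl -[X in _ *+ X]card_ord -sumr_const.
apply: ler_sum => j _; rewrite -mulr_sumr ler_wpM2l ?(ltW D0) //.
exact: decay.
Qed.

Lemma return_probability_decay v :
  (limn_esup (fun n : nat => mu [set x | Omega x /\
     (setT `*` [set v]) (iter n (extension theta kappa) (x, v))] `^ (n%:R^-1)) < 1)%E.
Proof.
have [z [L [t [D [k [[z1 L1 t01 D0 k0] bound]]]]]] := return_bound v.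
have [l l01 [N Nl]] := exp_decay_combine z1 L1 t01 D0 k0 bound.
pose B n := [set x | cocycle_iter theta kappa n x v = v].
have mB n : measurable (B n) by exact: (cocycle_set_measurable markov cocycle).
have BE n : [set x | Omega x /\
    (setT `*` [set v]) (iter n (extension theta kappa) (x, v))] = Omega `&` B n.
  by apply/seteqP; split => x /=; rewrite iter_extension /B /=; tauto.
have mOB n : measurable (Omega `&` B n) by exact: measurableI Omega_measurable _.
under eq_fun do rewrite BE -(fineK (fin_num_measure mu _ (mOB _))).
apply: (limn_esup_root_neq1 (l := l) (N := N)) => // n.
  by apply: fine_ge0; exact: measure_ge0.
move=> /Nl; apply: le_trans; have [h _] := restriction_ge (mB n); exact: h.
Qed.

End ReturnDecay.

(** * Amenability *)

Section AmenabilityCriterion.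
Context (R : realType) (d : measure_display) (X : measurableType d)
  (mu : probability X R) (V : countType) (E : set (V * V))
  (kappa : X -> V -> V).
Local Open Scope fset_scope.

(** Under the criterion [isoperimetric] vanishes at every positive [eps]; the vertex [v] makes the
    set of quotients nonempty. *)
Lemma mu_amenable_crit (v : V) :
  (forall eps e : R, 0 < eps -> 0 < e -> exists2 K : {fset V}, (0 < #|` K|)%N &
     #|` boundary mu E kappa eps K|%:R < e * #|` K|%:R) ->
  mu_amenable mu E kappa.
Proof.
move=> crit.
have iso0 eps : 0 < eps -> isoperimetric mu E kappa eps = 0.
  move=> eps0; rewrite /isoperimetric; set Q := [set q | _].
  have lbQ : lbound Q 0 by move=> _ [K _ ->]; rewrite divr_ge0.
  have hQ : has_lbound Q by exists 0.
  have Q0 : Q !=set0.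
    exists (#|` boundary mu E kappa eps [fset v]|%:R / #|` [fset v]|%:R).
    by exists [fset v] => //; rewrite cardfs1.
  apply/eqP; rewrite eq_le; apply/andP; split; last exact: lb_le_inf.
  apply/ler_addgt0Pr => e e0; rewrite add0r.
  have [K K0 Ke] := crit eps e eps0 e0.
  apply: (@le_trans _ _ (#|` boundary mu E kappa eps K|%:R / #|` K|%:R)).
    by apply: ge_inf => //; exists K.
  by rewrite ler_pdivrMr ?ltr0n // ltW.
apply: cvg_near_cst; near=> eps; rewrite iso0 //.
Unshelve. all: by end_near.
Qed.

End AmenabilityCriterion.

(** An empty cylinder would have an empty image, against full branches. The points so obtained give
    content to [finitely_covers], which quantifies over the points of a cylinder. *)
Lemma exists_in_cylinder (R : realType) (d : measure_display) (X : measurableType d)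
    (nu : probability X R) (I : countType) (P : set I) (cell : I -> set X)
    (theta : X -> X) (w : seq I) :
  markov_map_mod nu P cell theta -> full_branches nu P cell theta ->
  (forall i, i \in w -> P i) -> exists x, cyl cell theta w x.
Proof.
move=> mm full gw; apply: contrapT => nx.
have := cyl_image_full mm full gw.
rewrite /cyl_image (_ : cyl cell theta w = set0); last first.
  by apply/seteqP; split => // x wx; apply: nx; exists x.
rewrite image_set0 setC0 probability_setT => /eqP.
by rewrite onee_eq0.
Qed.

Theorem theoremB (R : realType) (d : measure_display) (X : measurableType d)
    (mu : probability X R) (A : countType) (cell : A -> set X) (theta : X -> X)
    (V : countType) (E : set (V * V)) (kappa : X -> V -> V)
    (Omega : set X) (beta : set (seq A)) (eta : seq A -> nat)
    (nu : probability X R) :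
  markov_map mu cell theta ->
  (forall B, measurable B -> mu (theta @^-1` B) = mu B) ->
  nearest_neighbour_cocycle cell E kappa ->
  topologically_transitive mu setT cell (extension theta kappa) ->
  adequately_embedded mu cell theta Omega beta eta nu ->
  cellwise_constant (induced_cocycle cell theta beta eta kappa)
    beta (cyl cell theta) ->
  topologically_transitive nu beta (cyl cell theta)
    (induced_extension cell theta beta eta kappa) ->
  uniform_loops cell theta Omega beta eta kappa ->
  exponential_decay mu cell theta Omega beta eta ->
  finitely_covers cell theta beta eta nu kappa ->
  (exists v : V,
     limn_esup (fun n : nat =>
       (mu [set x | Omega x /\
              (setT `*` [set v]) (iter n (extension theta kappa) (x, v))]
          `^ (n%:R^-1))%E) = 1%E) ->
  mu_amenable mu E kappa.
Proof.
move=> markov _ cocycle _ [r [r01 egm _ _]] khat_cst _ [J [Jfin JO loops]]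
  time_decay [W0 [W0fin W0adm cover]] [v lim1].
set kk := letter_action cell theta beta eta kappa.
have [bij _ _] := cocycle.
have kappa_inj x : injective (kappa x) by exact: bij_inj.
have kk_inj u : injective (kk u) by exact: letter_action_inj.
have [mm full _] := egm_gibbs_markov egm.
have [sJ JE] := (finite_seqP J).1 Jfin.
have [W WE] := (finite_seqP W0).1 W0fin.
pose lu x := odflt [::] (symbol beta (cyl cell theta) x).
have luP x : J x -> beta (lu x) /\ cyl cell theta (lu x) x.
  move=> /JO[_ /symbol_ex[u xu]]; rewrite /lu xu /=; exact: symbol_some xu.
(* Letters realizing the loops, for the gain in Cauchy-Schwarz, together with those of the covering
   words, for expansion. *)
pose S := undup (map lu sJ ++ flatten W).
have Wgood w : w \in W -> forall u, u \in w -> beta u.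
  move=> wW; have W0w : W0 w by rewrite WE.
  by have [_ h _] := W0adm w W0w.
have Sgood u : u \in S -> beta u.
  rewrite mem_undup mem_cat => /orP[/mapP[x xJ ->]|/flattenP[w wW uw]].
    by have /luP[] : J x by rewrite JE.
  exact: (Wgood w).
have WS w : w \in W -> {subset w <= S}.
  move=> wW u uw; rewrite mem_undup mem_cat; apply/orP; right.
  by apply/flattenP; exists w.
have Sloop g : exists2 u, u \in S & kk u g = g.
  have [x Jx xg] := loops g; have [bu ux] := luP x Jx.
  exists (lu x); last by rewrite /kk -(letter_actionE khat_cst g bu ux).
  rewrite mem_undup mem_cat map_f //.
  by move: Jx; rewrite JE.
have S0 : (0 < size S)%N by have [u uS _] := Sloop v; case: (S) uS.
apply: contrapT => nam; move: lim1; apply/eqP; rewrite lt_eqF //.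
have [eps [e [eps0 e0 big]]] : exists eps e : R, [/\ 0 < eps, 0 < e &
    forall K : {fset V}, (0 < #|` K|)%N ->
      e * #|` K|%:R <= #|` boundary mu E kappa eps K|%:R].
  apply: contrapT => h; apply: nam; apply: (mu_amenable_crit v) => eps e eps0 e0.
  apply: contrapT => h2; apply: h; exists eps, e; split => // K K0.
  by rewrite leNgt; apply/negP => Kb; apply: h2; exists K.
(* A boundary point leaves [K] along an edge of positive probability, hence by [kappa x] for some
   [x]; finite covering turns this move into the action of a word of [W]. *)
have expand (K : seq V) : uniq K -> e * (size K)%:R <=
    (count (fun g => has (fun w => act kk w g \notin K) W) K)%:R.
  move=> uK; have [->|K0] := eqVneq K [::]; first by rewrite mulr0.
  have cK : #|` [fset x in K]%fset| = size K by rewrite card_fseq undup_id.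
  have := big [fset x in K]%fset; rewrite cK => /(_ _)/le_trans; apply.
    by case: (K) K0.
  rewrite ler_nat -size_filter; pose P g := has (fun w => act kk w g \notin K) W.
  apply: (@leq_trans (#|` [fset x in [seq g <- K | P g]]%fset|)); last first.
    by rewrite card_fseq size_undup.
  apply: fsubset_leq_card; apply/fsubsetP => g.
  rewrite !inE /= mem_filter => /andP[gK /asboolP[[g1 g2] [_ /= -> g2K pe]]].
  rewrite gK andbT.
  have [x xg] : exists x, kappa x g = g2.
    apply: contrapT => nx; move: pe; rewrite /edge_prob /=.
    rewrite (_ : [set x | _] = set0) ?measure0 ?lte_fin ?ltNge ?(ltW eps0) //.
    by apply/seteqP; split => // x xg; apply: nx; exists x.
  have [a ax] : exists a, cell a x.
    have [_ _ cov _] := markov.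
    by have : [set: X] x by []; rewrite -cov => -[a _ ax]; exists a.
  have [w W0w wag] := cover a g.
  have wW : w \in W by move: W0w; rewrite WE.
  apply/hasP; exists w => //.
  have [y wy] := exists_in_cylinder mm full (Wgood w wW).
  rewrite /kk -(cocycle_iter_act khat_cst g (Wgood w wW) wy) -(wag x y ax wy) xg.
  by move: g2K; rewrite !inE.
have [c c0 cP] := letter_expansion kk_inj e0 WS expand.
have [q q01 gap] := l2_le_sum_gap kk_inj c0 cP S0 Sloop.
exact: (return_probability_decay markov cocycle r01 egm khat_cst time_decay
  (undup_uniq _) Sgood S0 q01 gap).
Qed.
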